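(* Let $\varphi\in\mathcal U(\mathbb D)$ be hyperbolic and let $\psi\in\mathcal Z(\varphi)$, both of them different from $\mathrm{id}_{\mathbb D}$. Then $\mathcal Z(\psi)=\mathcal Z(\varphi)$.
   Context: $\mathbb D=\{z\in\mathbb C:|z|<1\}$. $\mathcal U(\mathbb D)$ is the set of all univalent (injective holomorphic) self-maps of $\mathbb D$. The centralizer of $\varphi\in\mathcal U(\mathbb D)$ is $\mathcal Z(\varphi)=\{\psi\in\mathcal U(\mathbb D):\varphi\circ\psi=\psi\circ\varphi\}$. A holomorphic $\varphi:\mathbb D\to\mathbb D$ without fixed points in $\mathbb D$ is called non-elliptic; its iterates converge locally uniformly to a point $\tau\in\partial\mathbb D$ (the Denjoy–Wolff point), where the angular derivative $\varphi'(\tau)\in(0,1]$ exists; $\varphi$ is hyperbolic if $\varphi'(\tau)<1$. *)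

(* Defs.v *)
From Stdlib Require Import Reals.
From Coquelicot Require Import Coquelicot.
Open Scope R_scope.

(** A map defined on the unit disc is represented by a total function
    [C -> C] of which only the restriction to [disc] is ever used; hence
    equality of two such maps is [eq_on_disc], not Leibniz equality. *)

Definition disc (z : C) : Prop := Cmod z < 1.

Definition eq_on_disc (f g : C -> C) : Prop := forall z, disc z -> f z = g z.

Definition holomorphic_on_disc (f : C -> C) : Prop :=
  forall z, disc z -> @ex_derive C_AbsRing C_NormedModule f z.

Definition self_map (f : C -> C) : Prop := forall z, disc z -> disc (f z).

Definition injective_on_disc (f : C -> C) : Prop :=
  forall z w, disc z -> disc w -> f z = f w -> z = w.

Definition univalent_self_map (f : C -> C) : Prop :=
  holomorphic_on_disc f /\ self_map f /\ injective_on_disc f.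

Definition centralizer (f : C -> C) (g : C -> C) : Prop :=
  univalent_self_map g /\
  eq_on_disc (fun z => f (g z)) (fun z => g (f z)).

Definition non_elliptic (f : C -> C) : Prop :=
  holomorphic_on_disc f /\ self_map f /\ forall z, disc z -> f z <> z.

(** [tau] is a boundary point to which the iterates of [f] converge
    locally uniformly on the disc. *)
Definition is_denjoy_wolff_point (f : C -> C) (tau : C) : Prop :=
  Cmod tau = 1 /\
  forall z, disc z ->
    exists r : R, 0 < r /\
      forall eps : R, 0 < eps ->
        eventually (fun n => forall w, disc w -> Cmod (w - z) < r ->
          Cmod (Nat.iter n f w - tau) < eps).

Definition stolz_region (sigma : C) (M : R) (z : C) : Prop :=
  disc z /\ Cmod (sigma - z) < M * (1 - Cmod z).

(** Angular (non-tangential) limit at the boundary point [sigma]. *)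
Definition is_angular_lim (f : C -> C) (sigma l : C) : Prop :=
  forall M : R, 1 < M ->
    filterlim f (within (stolz_region sigma M) (locally sigma)) (locally l).

(** [omega] is the boundary value of [f] at [sigma]; it is [sigma] itself
    when [sigma] is the Denjoy-Wolff point. *)
Definition is_angular_derivative (f : C -> C) (sigma l : C) : Prop :=
  exists omega : C,
    is_angular_lim f sigma omega /\
    is_angular_lim (fun z => ((f z - omega) / (z - sigma))%C) sigma l.

Definition hyperbolic (f : C -> C) : Prop :=
  non_elliptic f /\
  exists (tau : C) (a : R),
    is_denjoy_wolff_point f tau /\
    is_angular_derivative f tau (RtoC a) /\
    0 < a < 1.

(* Main.v *)
Require Import Defs.
From Stdlib Require Import Reals Lra Lia Psatz ZArith ClassicalEpsilon.
From Coquelicot Require Import Coquelicot.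

(** Write [W = cayley tau], a conformal map of the disc onto the right
    half-plane sending the boundary point [tau] to infinity.  If [phi] is
    hyperbolic with Denjoy-Wolff point [tau], Julia's lemma gives a [lam > 1]
    with [Re (W (phi z)) >= lam * Re (W z)] for all [z] in the disc
    ([hyperbolic_julia_expanding]).  This is the property [julia_expanding];
    it makes sense for any map and any boundary point, and it is the only form
    of hyperbolicity used from then on.

    The centralizer of an expanding univalent [phi] is commutative
    ([centralizer_commutative]).  In the classical picture [phi] has a Koenigs
    function [sigma], injective, with [sigma (phi z) = lam * sigma z], and each
    [g] commuting with [phi] satisfies [sigma (g z) = c * sigma z] for a constant
    [c > 0]; so [sigma (g (h z)) = sigma (h (g z))].  The proof below runs this
    argument on orbits.  The relation [asymptotic phi tau c u v], which says that
    [W (phi^n u) = c * W (phi^n v)] up to a relative error tending to [0], takes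
    the place of [sigma u = c * sigma v].
    - Orbits tend to infinity non-tangentially ([orbit_nontangential]), hence
      the Julia-Caratheodory theorem applies along them and yields [c]
      ([commuting_multiplier]).
    - The injectivity of [sigma] becomes: orbits whose ratio tends to [1] start
      at the same point ([merging_eq]).  This is Hurwitz's theorem: near a point
      [a] other than [b], the functions measuring the hyperbolic distance from
      [phi^n z] to [phi^n b] do not vanish, and non-vanishing functions
      bounded by [1] that become small at [a] become small near [a].  So the set
      of starting points of orbits that merge with that of [b] is open and
      closed in the disc; it does not contain [phi b].

    Now let [psi] commute with [phi] and differ from the identity, with constant
    [c].  If [c = 1] then [psi z] and [z] have merging orbits and [psi z = z] for
    all [z]; so [c <> 1].  By the Schwarz-Pick lemma the distance from [psi^k 0]
    to [0] is at least the one read off at infinity, which is [k * |log c|].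
    Therefore [psi^k 0] tends to the boundary at a geometric rate, and Julia's
    lemma at a cluster point of this orbit shows that [psi] is expanding for some
    boundary point, possibly another one than [tau]
    ([commuting_julia_expanding]).  Hence the centralizers of [phi] and [psi] are
    both commutative, and each contains the other: if [chi] commutes with [psi],
    then [chi] and [phi] lie in the centralizer of [psi]; if [chi] commutes with
    [phi], then [chi] and [psi] lie in that of [phi].

    Complex differentiability is assumed pointwise only, so the Schwarz lemma is
    derived from Goursat's theorem through the mean value inequality and the
    maximum principle. *)

Open Scope R_scope.

(** * Complex differentiability *)

Definition ccont (f : C -> C) (z : C) : Prop :=
  forall eps, 0 < eps -> exists d, 0 < d /\
    forall w, Cmod (w - z) < d -> Cmod (f w - f z) < eps.

(** Caratheodory's form of differentiability: the difference quotient extends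
    continuously to [z].  It turns the rules of calculus into algebraic identities
    between quotients, and keeps the quotient available as a function, which the
    Schwarz lemma uses. *)
Definition cdiff (f : C -> C) (z : C) : Prop :=
  exists q : C -> C, ccont q z /\ forall w, (f w - f z = q w * (w - z))%C.

Lemma Cmod_minus_sym (a b : C) : Cmod (a - b) = Cmod (b - a).
Proof. rewrite <- Cmod_opp. f_equal. ring. Qed.

Lemma Cmod_triangle_minus (a b c : C) :
  Cmod (a - c) <= Cmod (a - b) + Cmod (b - c).
Proof. replace (a - c)%C with ((a - b) + (b - c))%C by ring. apply Cmod_triangle. Qed.

Lemma Cmod_minus_ge (a b : C) : Cmod a - Cmod b <= Cmod (a - b).
Proof.
  generalize (Cmod_triangle (a - b) b).
  replace (a - b + b)%C with a by ring. lra.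
Qed.

Lemma Cmod_plus_ge (a b : C) : Cmod a - Cmod b <= Cmod (a + b).
Proof.
  generalize (Cmod_minus_ge a (- b)). rewrite Cmod_opp.
  replace (a - - b)%C with (a + b)%C by ring. auto.
Qed.

Lemma Cmod_minus_le (a b : C) : Cmod (a - b) <= Cmod a + Cmod b.
Proof. unfold Cminus. rewrite <- (Cmod_opp b). apply Cmod_triangle. Qed.

Lemma Cmod_self_minus (a : C) : Cmod (a - a) = 0.
Proof. replace (a - a)%C with (RtoC 0) by ring. apply Cmod_0. Qed.

Lemma Cmod_pos_neq (a : C) : 0 < Cmod a -> a <> 0%C.
Proof. apply Cmod_gt_0. Qed.

Lemma Cminus_neq_0 (a b : C) : a <> b -> (a - b)%C <> 0%C.
Proof. intros H E. apply H. replace a with (a - b + b)%C by ring. rewrite E. ring. Qed.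

Lemma ccont_const (c z : C) : ccont (fun _ => c) z.
Proof. intros e He; exists 1; split; [lra|]. intros. rewrite Cmod_self_minus. lra. Qed.

Lemma ccont_id (z : C) : ccont (fun w => w) z.
Proof. intros e He; exists e; auto. Qed.

Lemma ccont_plus f g z : ccont f z -> ccont g z -> ccont (fun w => f w + g w)%C z.
Proof.
  intros Hf Hg e He.
  destruct (Hf (e/2)) as [d1 [? H1]]; [lra|]. destruct (Hg (e/2)) as [d2 [? H2]]; [lra|].
  exists (Rmin d1 d2); split; [now apply Rmin_pos|]. intros w Hw.
  assert (Cmod (w - z) < d1) by (eapply Rlt_le_trans; [exact Hw|apply Rmin_l]).
  assert (Cmod (w - z) < d2) by (eapply Rlt_le_trans; [exact Hw|apply Rmin_r]).
  specialize (H1 w). specialize (H2 w).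
  replace (f w + g w - (f z + g z))%C with ((f w - f z) + (g w - g z))%C by ring.
  generalize (Cmod_triangle (f w - f z) (g w - g z)). intuition lra.
Qed.

Lemma ccont_mult f g z : ccont f z -> ccont g z -> ccont (fun w => f w * g w)%C z.
Proof.
  intros Hf Hg e He.
  set (K := Cmod (f z) + Cmod (g z) + 1).
  assert (HK : 0 < K) by (unfold K; generalize (Cmod_ge_0 (f z)) (Cmod_ge_0 (g z)); lra).
  assert (Hd : 0 < Rmin 1 (e / K)) by (apply Rmin_pos; [lra|now apply Rdiv_lt_0_compat]).
  destruct (Hf (Rmin 1 (e/K)) Hd) as [d1 [? H1]]. destruct (Hg _ Hd) as [d2 [? H2]].
  exists (Rmin d1 d2); split; [now apply Rmin_pos|]. intros w Hw.
  assert (L1 : Cmod (w - z) < d1) by (eapply Rlt_le_trans; [exact Hw|apply Rmin_l]).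
  assert (L2 : Cmod (w - z) < d2) by (eapply Rlt_le_trans; [exact Hw|apply Rmin_r]).
  specialize (H1 w L1). specialize (H2 w L2).
  replace (f w * g w - f z * g z)%C
    with (((f w - f z) * (g w - g z) + (f w - f z) * g z) + f z * (g w - g z))%C by ring.
  eapply Rle_lt_trans; [apply Cmod_triangle|].
  eapply Rle_lt_trans; [apply Rplus_le_compat_r, Cmod_triangle|].
  rewrite !Cmod_mult.
  generalize (Rmin_l 1 (e/K)) (Rmin_r 1 (e/K)); intros M1 M2.
  generalize (Cmod_ge_0 (f z)) (Cmod_ge_0 (g z)) (Cmod_ge_0 (f w - f z)) (Cmod_ge_0 (g w - g z)); intros.
  set (x := Cmod (f w - f z)) in *. set (y := Cmod (g w - g z)) in *.
  set (m := Rmin 1 (e/K)) in *.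
  apply Rlt_le_trans with (m * K).
  - assert (x * y <= x * 1) by (apply Rmult_le_compat_l; lra).
    assert (x * Cmod (g z) <= m * Cmod (g z)) by (apply Rmult_le_compat_r; lra).
    assert (Cmod (f z) * y <= Cmod (f z) * m) by (apply Rmult_le_compat_l; lra).
    unfold K. lra.
  - apply Rle_trans with (e / K * K); [apply Rmult_le_compat_r; lra|]. right; field; lra.
Qed.

Lemma ccont_comp f g z : ccont f z -> ccont g (f z) -> ccont (fun w => g (f w)) z.
Proof.
  intros Hf Hg e He. destruct (Hg e He) as [d [Hd H1]]. destruct (Hf d Hd) as [d' [Hd' H2]].
  exists d'; auto.
Qed.

Lemma ccont_opp f z : ccont f z -> ccont (fun w => - f w)%C z.
Proof.
  intros Hf e He. destruct (Hf e He) as [d [Hd H]]. exists d; split; auto.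
  intros w Hw. replace (- f w - - f z)%C with (- (f w - f z))%C by ring. rewrite Cmod_opp. auto.
Qed.

Lemma ccont_Cinv (z : C) : z <> 0%C -> ccont Cinv z.
Proof.
  intros Hz e He. assert (Hm : 0 < Cmod z) by (apply Cmod_gt_0; auto).
  set (m := Cmod z) in *.
  exists (Rmin (m / 2) (e * m * m / 2)). split.
  { apply Rmin_pos; [lra|]. assert (0 < e * m * m) by (apply Rmult_lt_0_compat; [apply Rmult_lt_0_compat|]; auto). lra. }
  intros w Hw.
  assert (L1 : Cmod (w - z) < m / 2) by (eapply Rlt_le_trans; [exact Hw|apply Rmin_l]).
  assert (L2 : Cmod (w - z) < e * m * m / 2) by (eapply Rlt_le_trans; [exact Hw|apply Rmin_r]).
  assert (Hw2 : m / 2 <= Cmod w).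
  { generalize (Cmod_minus_ge z w). rewrite Cmod_minus_sym. fold m. lra. }
  assert (Hw0 : w <> 0%C) by (apply Cmod_pos_neq; lra).
  replace (/ w - / z)%C with ((z - w) / (w * z))%C by (field; auto).
  rewrite Cmod_div by (apply Cmult_neq_0; auto). rewrite Cmod_mult, Cmod_minus_sym. fold m.
  apply Rlt_div_l; [nra|].
  assert (m / 2 * m <= Cmod w * m) by nra. nra.
Qed.

Lemma cdiff_ccont f z : cdiff f z -> ccont f z.
Proof.
  intros [q [Hq H]].
  assert (Hc : ccont (fun w => f z + q w * (w + - z))%C z).
  { apply ccont_plus; [apply ccont_const|]. apply ccont_mult; auto.
    apply ccont_plus; [apply ccont_id|apply ccont_const]. }
  intros e He. destruct (Hc e He) as [d [Hd Hd2]]. exists d; split; auto. intros w Hw.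
  specialize (Hd2 w Hw). rewrite H.
  replace (q w * (w - z))%C with (f z + q w * (w + - z) - (f z + q z * (z + - z)))%C by ring. auto.
Qed.

Lemma cdiff_const c z : cdiff (fun _ => c) z.
Proof. exists (fun _ => RtoC 0); split; [apply ccont_const|]. intros; ring. Qed.

Lemma cdiff_id z : cdiff (fun w => w) z.
Proof. exists (fun _ => RtoC 1); split; [apply ccont_const|]. intros; ring. Qed.

Lemma cdiff_plus f g z : cdiff f z -> cdiff g z -> cdiff (fun w => f w + g w)%C z.
Proof.
  intros [q [Hq Hf]] [r [Hr Hg]]. exists (fun w => q w + r w)%C; split.
  - now apply ccont_plus.
  - intros w. replace (f w + g w - (f z + g z))%C with ((f w - f z) + (g w - g z))%C by ring.
    rewrite Hf, Hg; ring.
Qed.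

Lemma cdiff_mult f g z : cdiff f z -> cdiff g z -> cdiff (fun w => f w * g w)%C z.
Proof.
  intros [q [Hq Hf]] Hg'. assert (Hgc := cdiff_ccont _ _ Hg'). destruct Hg' as [r [Hr Hg]].
  exists (fun w => q w * g w + f z * r w)%C; split.
  - apply ccont_plus; apply ccont_mult; auto. apply ccont_const.
  - intros w. replace (f w * g w - f z * g z)%C with ((f w - f z) * g w + f z * (g w - g z))%C by ring.
    rewrite Hf, Hg; ring.
Qed.

Lemma cdiff_comp f g z : cdiff f z -> cdiff g (f z) -> cdiff (fun w => g (f w)) z.
Proof.
  intros Hf' [r [Hr Hg]]. assert (Hfc := cdiff_ccont _ _ Hf'). destruct Hf' as [q [Hq Hf]].
  exists (fun w => r (f w) * q w)%C; split.
  - apply ccont_mult; auto. now apply ccont_comp.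
  - intros w. rewrite Hg, Hf; ring.
Qed.

Lemma cdiff_opp f z : cdiff f z -> cdiff (fun w => - f w)%C z.
Proof.
  intros [q [Hq Hf]]. exists (fun w => - q w)%C; split; [now apply ccont_opp|].
  intros w. replace (- f w - - f z)%C with (- (f w - f z))%C by ring. rewrite Hf; ring.
Qed.

Lemma cdiff_minus f g z : cdiff f z -> cdiff g z -> cdiff (fun w => f w - g w)%C z.
Proof. intros; unfold Cminus. apply cdiff_plus; auto. now apply cdiff_opp. Qed.

Lemma ccont_ext_loc f g z d :
  0 < d -> (forall w, Cmod (w - z) < d -> f w = g w) -> ccont f z -> ccont g z.
Proof.
  intros Hd H Hf e He. destruct (Hf e He) as [d' [Hd' H']].
  exists (Rmin d d'); split; [now apply Rmin_pos|]. intros w Hw.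
  rewrite <- !H; [apply H'| |].
  - eapply Rlt_le_trans; [exact Hw|apply Rmin_r].
  - rewrite Cmod_self_minus; auto.
  - eapply Rlt_le_trans; [exact Hw|apply Rmin_l].
Qed.

Lemma cdiff_eps f z l :
  (forall eps, 0 < eps -> exists d, 0 < d /\ forall w, Cmod (w - z) < d ->
     Cmod (f w - f z - l * (w - z)) <= eps * Cmod (w - z)) -> cdiff f z.
Proof.
  intros H.
  exists (fun w => if Ceq_dec w z then l else (f w - f z) / (w - z))%C. split.
  - intros e He. destruct (H (e/2)) as [d [Hd Hd2]]; [lra|]. exists d; split; auto.
    intros w Hw. destruct (Ceq_dec z z) as [_|n]; [|now elim n].
    destruct (Ceq_dec w z) as [E|n]; [rewrite Cmod_self_minus; lra|].
    assert (Hwz := Cminus_neq_0 _ _ n).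
    replace ((f w - f z) / (w - z) - l)%C with ((f w - f z - l * (w - z)) / (w - z))%C by (field; auto).
    rewrite Cmod_div by auto. specialize (Hd2 w Hw).
    assert (0 < Cmod (w - z)) by (apply Cmod_gt_0; auto).
    apply Rle_lt_trans with (e / 2); [|lra].
    apply Rle_div_l; auto.
  - intros w. destruct (Ceq_dec w z) as [E|n].
    + rewrite E; ring.
    + field. now apply Cminus_neq_0.
Qed.

Lemma cdiff_inv_eps f z : cdiff f z -> exists l, forall eps, 0 < eps -> exists d, 0 < d /\
  forall w, Cmod (w - z) < d -> Cmod (f w - f z - l * (w - z)) <= eps * Cmod (w - z).
Proof.
  intros [q [Hq H]]. exists (q z). intros e He. destruct (Hq e He) as [d [Hd Hd2]].
  exists d; split; auto. intros w Hw. rewrite H.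
  replace (q w * (w - z) - q z * (w - z))%C with ((q w - q z) * (w - z))%C by ring.
  rewrite Cmod_mult. apply Rmult_le_compat_r; [apply Cmod_ge_0|]. left; auto.
Qed.

Lemma cdiff_ext_loc f g z d :
  0 < d -> (forall w, Cmod (w - z) < d -> f w = g w) -> cdiff f z -> cdiff g z.
Proof.
  intros Hd H Hf. destruct (cdiff_inv_eps _ _ Hf) as [l Hl]. apply cdiff_eps with l.
  intros e He. destruct (Hl e He) as [d' [Hd' H']].
  exists (Rmin d d'); split; [now apply Rmin_pos|]. intros w Hw.
  rewrite <- !H; [apply H'| |].
  - eapply Rlt_le_trans; [exact Hw|apply Rmin_r].
  - rewrite Cmod_self_minus; auto.
  - eapply Rlt_le_trans; [exact Hw|apply Rmin_l].
Qed.

Lemma cdiff_Cinv (z : C) : z <> 0%C -> cdiff Cinv z.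
Proof.
  intros Hz. assert (Hm : 0 < Cmod z) by (apply Cmod_gt_0; auto).
  exists (fun w => if Ceq_dec w 0%C then / (z * z) else - (/ w * / z))%C. split.
  - apply ccont_ext_loc with (fun w => - (/ w * / z))%C (Cmod z); auto.
    + intros w Hw. destruct (Ceq_dec w 0%C) as [E|n]; auto. exfalso.
      rewrite E, Cmod_minus_sym in Hw. replace (z - 0)%C with z in Hw by ring. lra.
    + apply ccont_opp, ccont_mult; [now apply ccont_Cinv|apply ccont_const].
  - intros w. destruct (Ceq_dec w 0%C) as [E|n].
    (* [Cinv 0 = 0]; the quotient at [w = 0] is chosen to match this value. *)
    + rewrite E. replace (/ 0)%C with (RtoC 0); [field; auto|].
      unfold Cinv, RtoC; simpl. f_equal; unfold Rdiv; ring.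
    + field. auto.
Qed.

Lemma cdiff_div f g z : cdiff f z -> cdiff g z -> g z <> 0%C -> cdiff (fun w => f w / g w)%C z.
Proof.
  intros. unfold Cdiv. apply cdiff_mult; auto.
  apply (cdiff_comp g Cinv); auto. now apply cdiff_Cinv.
Qed.

Lemma cdiff_pow f z n : cdiff f z -> cdiff (fun w => f w ^ n)%C z.
Proof.
  intros Hf; induction n; simpl; [apply cdiff_const|]. now apply cdiff_mult.
Qed.

Lemma ex_derive_cdiff f z : @ex_derive C_AbsRing C_NormedModule f z -> cdiff f z.
Proof.
  intros [l [_ H]]. apply cdiff_eps with l. intros e He.
  destruct (H z (fun P HP => HP) (mkposreal e He)) as [d Hd].
  exists d; split; [apply cond_pos|]. intros w Hw.
  specialize (Hd w Hw).
  replace (f w - f z - l * (w - z))%C with (f w - f z - (w - z) * l)%C by ring. exact Hd.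
Qed.

(** * Goursat's theorem *)

Section Bisection.

Variable J : R -> R -> R -> R -> R.
Variables a0 b0 c0 d0 : R.
Hypothesis Hab : a0 <= b0.
Hypothesis Hcd : c0 <= d0.
Hypothesis add_h : forall a m b c d, a0 <= a -> a <= m -> m <= b -> b <= b0 ->
  c0 <= c -> c <= d -> d <= d0 -> J a b c d = J a m c d + J m b c d.
Hypothesis add_v : forall a b c m d, a0 <= a -> a <= b -> b <= b0 ->
  c0 <= c -> c <= m -> m <= d -> d <= d0 -> J a b c d = J a b c m + J a b m d.

Let L n := (b0 - a0) / 2 ^ n.
Let H n := (d0 - c0) / 2 ^ n.

(** Among the four quarters of a rectangle, one carries at least a quarter of
    [|J|]; iterating, the value at level [n] is at least [|J| / 4 ^ n]. *)
Let good n (p : R * R) := a0 <= fst p /\ fst p + L n <= b0 /\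
  c0 <= snd p /\ snd p + H n <= d0 /\
  Rabs (J a0 b0 c0 d0) / 4 ^ n <= Rabs (J (fst p) (fst p + L n) (snd p) (snd p + H n)).

Let finer n (p p' : R * R) := fst p <= fst p' /\ fst p' + L (S n) <= fst p + L n /\
  snd p <= snd p' /\ snd p' + H (S n) <= snd p + H n.

Lemma bisection_half n : L n = 2 * L (S n) /\ H n = 2 * H (S n) /\ 0 <= L n /\ 0 <= H n.
Proof using Hab Hcd.
  assert (0 < 2 ^ n) by (apply pow_lt; lra).
  unfold L, H; simpl. repeat split; try (field; lra);
  apply Rmult_le_pos; try lra; left; now apply Rinv_0_lt_compat.
Qed.

Lemma bisection_step n p : good n p -> exists p', good (S n) p' /\ finer n p p'.
Proof using Hab Hcd add_h add_v.
  destruct p as [a c]. intros (Ga & Gb & Gc & Gd & GJ). simpl in *.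
  destruct (bisection_half n) as (EL & EH & PL & PH).
  set (l := L (S n)) in *. set (h := H (S n)) in *. rewrite EL, EH in *.
  rewrite (add_h a (a + l) (a + 2 * l)) in GJ by lra.
  rewrite (add_v a (a + l) c (c + h) (c + 2 * h)) in GJ by lra.
  rewrite (add_v (a + l) (a + 2 * l) c (c + h) (c + 2 * h)) in GJ by lra.
  assert (E4 : Rabs (J a0 b0 c0 d0) / 4 ^ n = 4 * (Rabs (J a0 b0 c0 d0) / 4 ^ S n)).
  { simpl. field. apply pow_nonzero. lra. }
  rewrite E4 in GJ. set (t := Rabs (J a0 b0 c0 d0) / 4 ^ S n) in *.
  assert (B : forall x y, x = a \/ x = a + l -> y = c \/ y = c + h ->
     t <= Rabs (J x (x + l) y (y + h)) -> exists p', good (S n) p' /\ finer n (a, c) p').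
  { intros x y Hx Hy Ht. exists (x, y). unfold good, finer; simpl. fold l h t.
    rewrite EL, EH. destruct Hx, Hy; subst; repeat split; auto; lra. }
  destruct (Rle_dec t (Rabs (J a (a + l) c (c + h)))) as [T|T1]; [apply (B a c); auto|].
  destruct (Rle_dec t (Rabs (J a (a + l) (c + h) (c + h + h)))) as [T|T2]; [apply (B a (c + h)); auto|].
  destruct (Rle_dec t (Rabs (J (a + l) (a + l + l) c (c + h)))) as [T|T3]; [apply (B (a + l) c); auto|].
  destruct (Rle_dec t (Rabs (J (a + l) (a + l + l) (c + h) (c + h + h)))) as [T|T4];
    [apply (B (a + l) (c + h)); auto|].
  exfalso.
  replace (a + 2 * l) with (a + l + l) in GJ by ring.
  replace (c + 2 * h) with (c + h + h) in GJ by ring.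
  revert GJ. apply Rlt_not_le.
  eapply Rle_lt_trans; [apply Rabs_triang|].
  generalize (Rabs_triang (J a (a + l) c (c + h)) (J a (a + l) (c + h) (c + h + h)))
   (Rabs_triang (J (a + l) (a + l + l) c (c + h)) (J (a + l) (a + l + l) (c + h) (c + h + h))).
  lra.
Qed.

(** An additive rectangle function that is negligible with respect to the squared
    size of small rectangles around each point vanishes: the nested rectangles
    selected by bisection shrink to a point, where the local estimate contradicts
    the lower bound [|J| / 4 ^ n]. *)
Lemma bisection_zero :
  (forall x y, a0 <= x <= b0 -> c0 <= y <= d0 -> forall eps, 0 < eps -> exists del, 0 < del /\
    forall a b c d, a0 <= a -> a <= x -> x <= b -> b <= b0 -> c0 <= c -> c <= y -> y <= d -> d <= d0 ->
      b - a < del -> d - c < del -> Rabs (J a b c d) <= eps * ((b - a) + (d - c)) ^ 2) ->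
  J a0 b0 c0 d0 = 0.
Proof using Hab Hcd add_h add_v.
  intros loc.
  assert (G0 : good 0 (a0, c0)).
  { unfold good, L, H; simpl.
    replace (a0 + (b0 - a0) / 1) with b0 by field. replace (c0 + (d0 - c0) / 1) with d0 by field.
    unfold Rdiv. rewrite Rinv_1, Rmult_1_r. repeat split; lra. }
  pose (st := fix st n : {p | good n p} := match n with
     | O => exist _ (a0, c0) G0
     | S m => let (p, Hp) := st m in
        let (p', Hp') := constructive_indefinite_description _ (bisection_step m p Hp) in
        exist _ p' (proj1 Hp') end).
  pose (s n := proj1_sig (st n)).
  assert (Sg : forall n, good n (s n)) by (intros n; exact (proj2_sig (st n))).
  assert (Sf : forall n, finer n (s n) (s (S n))).
  { intros n. unfold s; simpl. destruct (st n) as [p Hp]; simpl.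
    destruct constructive_indefinite_description as [p' [H1 H2]]; simpl. auto. }
  clearbody s. clear st.
  assert (Mono : forall n k, fst (s n) <= fst (s (n + k)%nat) /\
     fst (s (n + k)%nat) + L (n + k) <= fst (s n) + L n /\
     snd (s n) <= snd (s (n + k)%nat) /\
     snd (s (n + k)%nat) + H (n + k) <= snd (s n) + H n).
  { intros n k. induction k as [|k IH].
    - rewrite Nat.add_0_r. repeat split; lra.
    - rewrite Nat.add_succ_r. destruct (Sf (n + k)%nat) as (?&?&?&?). repeat split; lra. }
  assert (Cross : forall n m, fst (s n) <= fst (s m) + L m /\ snd (s n) <= snd (s m) + H m).
  { intros n m. destruct (Nat.le_ge_cases n m) as [Hl|Hl].
    - destruct (Mono n (m - n)%nat) as (?&?&?&?). replace (n + (m - n))%nat with m in * by lia.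
      destruct (bisection_half m) as (?&?&?&?). lra.
    - destruct (Mono m (n - m)%nat) as (?&?&?&?). replace (m + (n - m))%nat with n in * by lia.
      destruct (bisection_half n) as (?&?&?&?). lra. }
  assert (Ex : exists x, forall n, fst (s n) <= x <= fst (s n) + L n).
  { destruct (completeness (fun r => exists n, r = fst (s n))) as [x [U V]].
    - exists (fst (s O) + L O). intros r [n ->]. apply Cross.
    - exists (fst (s O)). now exists O.
    - exists x. intros n; split; [apply U; now exists n|]. apply V. intros r [k ->]. apply Cross. }
  assert (Ey : exists y, forall n, snd (s n) <= y <= snd (s n) + H n).
  { destruct (completeness (fun r => exists n, r = snd (s n))) as [x [U V]].
    - exists (snd (s O) + H O). intros r [n ->]. apply Cross.
    - exists (snd (s O)). now exists O.
    - exists x. intros n; split; [apply U; now exists n|]. apply V. intros r [k ->]. apply Cross. }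
  destruct Ex as [x Hx]. destruct Ey as [y Hy].
  set (K := (b0 - a0) + (d0 - c0)).
  assert (Main : forall eps, 0 < eps -> Rabs (J a0 b0 c0 d0) <= eps * K ^ 2).
  { intros eps He.
    destruct (loc x y) with (eps := eps) as [del [Hd Hdel]]; auto.
    { destruct (Sg O) as (?&?&?&?&?). generalize (Hx O). lra. }
    { destruct (Sg O) as (?&?&?&?&?). generalize (Hy O). lra. }
    assert (HK : 0 <= K) by (unfold K; lra).
    assert (HKd : K / del < 2 ^ Z.to_nat (up (K / del))).
    { set (k := up (K / del)). destruct (archimed (K / del)) as [A _]. fold k in A.
      assert (0 <= K / del) by (apply Rmult_le_pos; [lra|left; now apply Rinv_0_lt_compat]).
      assert (0 <= k)%Z by (apply le_IZR; lra).
      apply Rlt_trans with (INR (Z.to_nat k)).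
      - rewrite INR_IZR_INZ, Z2Nat.id by auto. lra.
      - generalize (Z.to_nat k). intros n. induction n; simpl; [lra|].
        change (match n with O => 1 | S _ => INR n + 1 end) with (INR (S n)). rewrite S_INR.
        assert (1 <= 2 ^ n) by (apply pow_R1_Rle; lra). lra. }
    set (n := Z.to_nat (up (K / del))) in *.
    assert (P2 : 0 < 2 ^ n) by (apply pow_lt; lra).
    assert (Ksm : L n + H n < del).
    { replace (L n + H n) with (K / 2 ^ n) by (unfold L, H, K; field; lra).
      apply Rlt_div_l; auto. apply Rlt_div_l in HKd; auto. lra. }
    destruct (Sg n) as (G1&G2&G3&G4&G5). destruct (bisection_half n) as (_&_&PL&PH).
    generalize (Hx n) (Hy n); intros HHx HHy.
    assert (B := Hdel (fst (s n)) (fst (s n) + L n) (snd (s n)) (snd (s n) + H n)).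
    assert (B' : Rabs (J (fst (s n)) (fst (s n) + L n) (snd (s n)) (snd (s n) + H n)) <= eps * (L n + H n) ^ 2).
    { eapply Rle_trans; [apply B; lra|]. right. ring. }
    assert (P4 : 4 ^ n = 2 ^ n * 2 ^ n) by (rewrite <- Rpow_mult_distr; f_equal; lra).
    assert (C := Rle_trans _ _ _ G5 B').
    apply (proj1 (Rle_div_l _ _ (4 ^ n) ltac:(apply pow_lt; lra))) in C.
    replace (eps * (L n + H n) ^ 2 * 4 ^ n) with (eps * K ^ 2) in C; auto.
    rewrite P4. unfold L, H, K. field. lra. }
  destruct (Req_dec (J a0 b0 c0 d0) 0) as [E|E]; auto. exfalso.
  apply Rabs_pos_lt in E.
  assert (0 <= K ^ 2) by nra.
  assert (M := Main (Rabs (J a0 b0 c0 d0) / (2 * (K ^ 2 + 1)))).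
  set (j := Rabs (J a0 b0 c0 d0)) in *.
  assert (M1 : 0 < j / (2 * (K ^ 2 + 1))) by (apply Rdiv_lt_0_compat; lra).
  specialize (M M1).
  assert (j / (2 * (K ^ 2 + 1)) * (2 * (K ^ 2 + 1)) = j) by (field; lra).
  nra.
Qed.

End Bisection.

Lemma Cmod_le_abs (x y : R) : Cmod (x, y) <= Rabs x + Rabs y.
Proof.
  replace ((x, y) : C) with (RtoC x + Ci * RtoC y)%C.
  - eapply Rle_trans; [apply Cmod_triangle|].
    rewrite Cmod_mult, Cmod_Ci, !Cmod_R. lra.
  - unfold Ci, RtoC, Cplus, Cmult; simpl. f_equal; ring.
Qed.

Lemma Rabs_Im_le_Cmod (z : C) : Rabs (snd z) <= Cmod z.
Proof. eapply Rle_trans; [|apply Rmax_Cmod]. apply Rmax_r. Qed.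

Lemma Rabs_Re_le_Cmod (z : C) : Rabs (fst z) <= Cmod z.
Proof. eapply Rle_trans; [|apply Rmax_Cmod]. apply Rmax_l. Qed.

Lemma Re_le_Cmod (z : C) : Re z <= Cmod z.
Proof. eapply Rle_trans; [apply Rle_abs|]. apply re_le_Cmod. Qed.

Lemma continuous_eps (g : R -> R) (t : R) :
  (forall eps, 0 < eps -> exists d, 0 < d /\ forall s, Rabs (s - t) < d -> Rabs (g s - g t) < eps) ->
  continuous g t.
Proof.
  intros H. apply continuity_pt_filterlim. intros e He. destruct (H e He) as [d [Hd Hd2]].
  exists d; split; auto. intros s [_ Hs]. apply Hd2. exact Hs.
Qed.

Lemma ccont_slices (F : C -> C) (x y : R) : ccont F (x, y) ->
  continuous (fun t => Re (F (x, t))) y /\ continuous (fun s => Im (F (s, y))) x.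
Proof.
  intros HF. split; apply continuous_eps; intros e He;
  destruct (HF e He) as [d [Hd H]]; exists d; (split; [auto|]); intros s Hs.
  - eapply Rle_lt_trans; [|apply (H (x, s))].
    + apply (Rabs_Re_le_Cmod (F (x, s) - F (x, y))%C).
    + eapply Rle_lt_trans; [apply Cmod_le_abs|]; simpl.
      replace (x + - x) with 0 by ring. rewrite Rabs_R0. unfold Rminus in Hs; lra.
  - eapply Rle_lt_trans; [|apply (H (s, y))].
    + apply (Rabs_Im_le_Cmod (F (s, y) - F (x, y))%C).
    + eapply Rle_lt_trans; [apply Cmod_le_abs|]; simpl.
      replace (y + - y) with 0 by ring. rewrite Rabs_R0. unfold Rminus in Hs; lra.
Qed.

(** The imaginary part of the integral of [F] along the boundary of the rectangle
    [[a, b] x [c, d]], traversed counterclockwise. *)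
Definition contour (F : C -> C) (a b c d : R) : R :=
  RInt (fun t => Re (F (b, t))) c d - RInt (fun t => Re (F (a, t))) c d
  + RInt (fun s => Im (F (s, c))) a b - RInt (fun s => Im (F (s, d))) a b.

Lemma RInt_diff_bound (f g : R -> R) (a b k e : R) : a <= b ->
  ex_RInt f a b -> ex_RInt g a b ->
  (forall t, a <= t <= b -> Rabs (f t - g t - k) <= e) ->
  Rabs (RInt f a b - RInt g a b - k * (b - a)) <= (b - a) * e.
Proof.
  intros Hab Hf Hg H.
  assert (E1 : ex_RInt (fun t => minus (f t) (g t)) a b) by now apply @ex_RInt_minus.
  assert (E2 : ex_RInt (fun _ => k) a b) by apply @ex_RInt_const.
  replace (RInt f a b - RInt g a b - k * (b - a))
    with (RInt (fun t => minus (minus (f t) (g t)) k) a b).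
  - apply abs_RInt_le_const; auto. now apply @ex_RInt_minus.
  - rewrite (RInt_minus (fun t => minus (f t) (g t)) (fun _ => k)) by auto.
    rewrite (RInt_minus f g) by auto. rewrite RInt_const.
    unfold minus, plus, opp, scal; simpl. unfold mult; simpl. ring.
Qed.

(** The affine part of [F] at a point contributes nothing to the contour, and the
    remainder is small compared with the size of the rectangle, on a contour of
    comparable length: this is the local estimate required by bisection. *)
Lemma goursat (F : C -> C) (a0 b0 c0 d0 : R) : a0 <= b0 -> c0 <= d0 ->
  (forall s t, a0 <= s <= b0 -> c0 <= t <= d0 -> cdiff F (s, t)) ->
  contour F a0 b0 c0 d0 = 0.
Proof.
  intros Hab Hcd HF.
  assert (Iv : forall s c d, a0 <= s <= b0 -> c0 <= c -> c <= d -> d <= d0 ->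
    ex_RInt (fun t => Re (F (s, t))) c d).
  { intros s c d Hs Hc Hd Hd2. apply @ex_RInt_continuous. intros z.
    rewrite Rmin_left, Rmax_right by auto. intros Hz.
    apply (ccont_slices F s z). apply cdiff_ccont, HF; lra. }
  assert (Ih : forall t a b, c0 <= t <= d0 -> a0 <= a -> a <= b -> b <= b0 ->
    ex_RInt (fun s => Im (F (s, t))) a b).
  { intros t a b Hs Hc Hd Hd2. apply @ex_RInt_continuous. intros z.
    rewrite Rmin_left, Rmax_right by auto. intros Hz.
    apply (ccont_slices F z t). apply cdiff_ccont, HF; lra. }
  apply bisection_zero with (J := contour F); auto.
  - intros a m b c d; intros. unfold contour.
    rewrite <- (RInt_Chasles (fun s => Im (F (s, c))) a m b) by (apply Ih; lra).
    rewrite <- (RInt_Chasles (fun s => Im (F (s, d))) a m b) by (apply Ih; lra).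
    unfold plus; simpl. ring.
  - intros a b c m d; intros. unfold contour.
    rewrite <- (RInt_Chasles (fun t => Re (F (a, t))) c m d) by (apply Iv; lra).
    rewrite <- (RInt_Chasles (fun t => Re (F (b, t))) c m d) by (apply Iv; lra).
    unfold plus; simpl. ring.
  - intros x y Hx Hy eps He.
    destruct (cdiff_inv_eps _ _ (HF x y Hx Hy)) as [l Hl].
    destruct (Hl (eps / 2)) as [del [Hdel Hd]]; [lra|].
    exists (del / 2). split; [lra|].
    intros a b c d Ha Hax Hxb Hb Hc Hcy Hyd Hdd Hba Hdc.
    set (S := (b - a) + (d - c)).
    assert (Err : forall s t, a <= s <= b -> c <= t <= d ->
      exists e : C, F (s, t) = (F (x, y) + l * ((s, t) - (x, y)) + e)%C /\ Cmod e <= eps / 2 * S).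
    { intros s t Hs Ht. exists (F (s, t) - F (x, y) - l * ((s, t) - (x, y)))%C. split; [ring|].
      assert (B : Cmod ((s, t) - (x, y)) <= S).
      { eapply Rle_trans; [apply Cmod_le_abs|]. simpl. unfold S.
        apply Rplus_le_compat; apply Rabs_le; lra. }
      eapply Rle_trans; [apply Hd|].
      - eapply Rle_lt_trans; [exact B|]. unfold S; lra.
      - apply Rmult_le_compat_l; lra. }
    assert (V : Rabs (RInt (fun t => Re (F (b, t))) c d - RInt (fun t => Re (F (a, t))) c d
        - Re l * (b - a) * (d - c)) <= (d - c) * (eps * S)).
    { apply RInt_diff_bound; [lra| apply Iv; lra | apply Iv; lra |].
      intros t Ht. destruct (Err b t) as [e1 [-> He1]]; [lra|auto|].
      destruct (Err a t) as [e2 [-> He2]]; [lra|auto|].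
      generalize (Rabs_Re_le_Cmod e1) (Rabs_Re_le_Cmod e2). intros R1 R2.
      replace (Re (F (x, y) + l * ((b, t) - (x, y)) + e1) -
        Re (F (x, y) + l * ((a, t) - (x, y)) + e2) - Re l * (b - a)) with (fst e1 - fst e2).
      - eapply Rle_trans; [apply Rabs_triang|]. rewrite Rabs_Ropp. lra.
      - unfold Re; simpl. ring. }
    assert (U : Rabs (RInt (fun s => Im (F (s, c))) a b - RInt (fun s => Im (F (s, d))) a b
        - Re l * (c - d) * (b - a)) <= (b - a) * (eps * S)).
    { apply RInt_diff_bound; [lra| apply Ih; lra | apply Ih; lra |].
      intros s Hs. destruct (Err s c) as [e1 [-> He1]]; [auto|lra|].
      destruct (Err s d) as [e2 [-> He2]]; [auto|lra|].
      generalize (Rabs_Im_le_Cmod e1) (Rabs_Im_le_Cmod e2). intros R1 R2.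
      replace (Im (F (x, y) + l * ((s, c) - (x, y)) + e1) -
        Im (F (x, y) + l * ((s, d) - (x, y)) + e2) - Re l * (c - d)) with (snd e1 - snd e2).
      - eapply Rle_trans; [apply Rabs_triang|]. rewrite Rabs_Ropp. lra.
      - unfold Im, Re; simpl. ring. }
    fold S.
    set (A := RInt (fun t => Re (F (b, t))) c d - RInt (fun t => Re (F (a, t))) c d) in *.
    set (B := RInt (fun s => Im (F (s, c))) a b - RInt (fun s => Im (F (s, d))) a b) in *.
    replace (contour F a b c d) with ((A - Re l * (b - a) * (d - c)) + (B - Re l * (c - d) * (b - a)))
      by (unfold contour, A, B; ring).
    eapply Rle_trans; [apply Rabs_triang|].
    replace (eps * S ^ 2) with ((d - c) * (eps * S) + (b - a) * (eps * S)) by (unfold S; ring).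
    lra.
Qed.

(** * The mean value inequality *)

Definition cexp (z : C) : C := (exp (fst z) * cos (snd z), exp (fst z) * sin (snd z)).

Lemma cexp_plus (z w : C) : cexp (z + w) = (cexp z * cexp w)%C.
Proof.
  unfold cexp, Cmult, Cplus; simpl. rewrite exp_plus, cos_plus, sin_plus. f_equal; ring.
Qed.

Lemma Cmod_cexp (z : C) : Cmod (cexp z) = exp (fst z).
Proof.
  unfold Cmod, cexp; simpl.
  replace (exp (fst z) * cos (snd z) * (exp (fst z) * cos (snd z) * 1) +
     exp (fst z) * sin (snd z) * (exp (fst z) * sin (snd z) * 1)) with
   ((exp (fst z)) * (exp (fst z)) * ((sin (snd z))² + (cos (snd z))²)) by (unfold Rsqr; ring).
  rewrite sin2_cos2, Rmult_1_r. apply sqrt_square. left; apply exp_pos.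
Qed.

Lemma derivable_small (g : R -> R) (l : R) : derivable_pt_lim g 0 l ->
  forall eps, 0 < eps -> exists d, 0 < d /\
    forall h, Rabs h < d -> Rabs (g h - g 0 - l * h) <= eps * Rabs h.
Proof.
  intros Hg eps He. destruct (Hg eps He) as [[d Hd] H]. exists d; split; auto.
  intros h Hh. destruct (Req_dec h 0) as [->|n].
  - rewrite Rabs_R0. replace (g 0 - g 0 - l * 0) with 0 by ring. rewrite Rabs_R0. lra.
  - specialize (H h n Hh). rewrite Rplus_0_l in H.
    replace (g h - g 0 - l * h) with (((g h - g 0) / h - l) * h) by (field; auto).
    rewrite Rabs_mult. apply Rmult_le_compat_r; [apply Rabs_pos|]. lra.
Qed.

Lemma cdiff_cexp_0 : cdiff cexp (RtoC 0).
Proof.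
  apply cdiff_eps with (RtoC 1). intros eps0 He0.
  set (eps := Rmin (eps0 / 10) (1 / 10)).
  assert (He : 0 < eps) by (apply Rmin_pos; lra).
  assert (Hl : eps <= eps0 / 10) by apply Rmin_l.
  assert (Hl2 : eps <= 1 / 10) by apply Rmin_r. clearbody eps.
  destruct (derivable_small exp 1) with (eps := eps) as [d1 [Hd1 H1]]; auto.
  { rewrite <- exp_0. apply derivable_pt_lim_exp. }
  destruct (derivable_small cos 0) with (eps := eps) as [d2 [Hd2 H2]]; auto.
  { generalize (derivable_pt_lim_cos 0). rewrite sin_0, Ropp_0. auto. }
  destruct (derivable_small sin 1) with (eps := eps) as [d3 [Hd3 H3]]; auto.
  { rewrite <- cos_0. apply derivable_pt_lim_sin. }
  rewrite exp_0 in H1. rewrite cos_0 in H2. rewrite sin_0 in H3.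
  exists (Rmin (Rmin d1 d2) (Rmin d3 eps)). split; [repeat apply Rmin_pos; auto|].
  intros w Hw. replace (w - 0)%C with w in * by ring. destruct w as [x y].
  set (m := Cmod (x, y)) in *.
  assert (m < d1 /\ m < d2 /\ m < d3 /\ m < eps) as (M1 & M2 & M3 & M4).
  { generalize (Rmin_l (Rmin d1 d2) (Rmin d3 eps)) (Rmin_r (Rmin d1 d2) (Rmin d3 eps))
     (Rmin_l d1 d2) (Rmin_r d1 d2) (Rmin_l d3 eps) (Rmin_r d3 eps). lra. }
  assert (X := Rabs_Re_le_Cmod (x, y)). assert (Y := Rabs_Im_le_Cmod (x, y)). simpl in X, Y. fold m in X, Y.
  specialize (H1 x ltac:(lra)). specialize (H2 y ltac:(lra)). specialize (H3 y ltac:(lra)).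
  replace (cexp (x, y) - cexp 0 - 1 * (x, y))%C with
    (((exp x - 1 - 1 * x) * cos y + (1 + x) * (cos y - 1 - 0 * y),
     (exp x - 1 - 1 * x + x) * sin y + (sin y - 0 - 1 * y)) : C).
  2:{ unfold cexp; simpl. unfold RtoC, Cminus, Cmult, Cplus, Copp; simpl.
      rewrite exp_0, cos_0, sin_0. f_equal; ring. }
  eapply Rle_trans; [apply Cmod_le_abs|].
  assert (Rabs (cos y) <= 1) by (apply Rabs_le; generalize (COS_bound y); lra).
  set (e1 := exp x - 1 - 1 * x) in *. set (e2 := cos y - 1 - 0 * y) in *. set (e3 := sin y - 0 - 1 * y) in *.
  assert (Hm0 : 0 <= m) by apply Cmod_ge_0.
  assert (Rabs (sin y) <= 2 * m).
  { replace (sin y) with (e3 + y) by (unfold e3; ring).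
    eapply Rle_trans; [apply Rabs_triang|]. nra. }
  assert (Rabs (1 + x) <= 2).
  { eapply Rle_trans; [apply Rabs_triang|]. rewrite Rabs_R1. lra. }
  assert (Rabs (e1 + x) <= 2 * m).
  { eapply Rle_trans; [apply Rabs_triang|]. nra. }
  assert (G1 : Rabs (e1 * cos y + (1 + x) * e2) <= eps * m * 1 + 2 * (eps * m)).
  { eapply Rle_trans; [apply Rabs_triang|]. rewrite !Rabs_mult.
    apply Rplus_le_compat; apply Rmult_le_compat; auto using Rabs_pos; nra. }
  assert (G2 : Rabs ((e1 + x) * sin y + e3) <= 2 * m * (2 * eps) + eps * m).
  { eapply Rle_trans; [apply Rabs_triang|]. rewrite !Rabs_mult.
    apply Rplus_le_compat; [|nra]. apply Rmult_le_compat; auto using Rabs_pos; lra. }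
  nra.
Qed.

Lemma cdiff_cexp z : cdiff cexp z.
Proof.
  apply cdiff_ext_loc with (fun w => cexp z * cexp (w + - z))%C 1; [lra| |].
  - intros w _. rewrite <- cexp_plus. f_equal. ring.
  - apply cdiff_mult; [apply cdiff_const|].
    apply (cdiff_comp (fun w => w + - z)%C cexp).
    + apply cdiff_plus; [apply cdiff_id|apply cdiff_const].
    + replace (z + - z)%C with (RtoC 0) by ring. apply cdiff_cexp_0.
Qed.

Definition hol (f : C -> C) := forall z, Cmod z < 1 -> cdiff f z.

(** In the coordinate [log z] the annulus between a small circle and the circle of
    radius [r] is a rectangle, on whose horizontal sides [f (cexp z)] takes the same
    values.  Goursat's theorem thus says that the averages of [Re f] over both circles
    agree, and the average over the small one is close to [Re (f 0)]. *)
Lemma mean_value_Re (f : C -> C) (r M : R) : hol f -> 0 < r < 1 ->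
  (forall z, Cmod z = r -> Cmod (f z) <= M) -> Re (f 0%C) <= M.
Proof.
  intros Hf [Hr0 Hr1] HM. apply le_epsilon. intros eps He.
  destruct (cdiff_ccont f 0%C (Hf 0%C ltac:(rewrite Cmod_0; lra)) eps He) as [d [Hd Hc]].
  set (F z := f (cexp z)).
  set (r0 := Rmin (d / 2) (r / 2)).
  assert (Hr00 : 0 < r0) by (apply Rmin_pos; lra).
  assert (r0 <= d / 2) by apply Rmin_l. assert (r0 <= r / 2) by apply Rmin_r. clearbody r0.
  set (s0 := ln r0). set (s1 := ln r).
  assert (Hs : s0 < s1) by (apply ln_increasing; lra).
  assert (Hs1 : s1 < 0) by (rewrite <- ln_1; apply ln_increasing; lra).
  assert (HF : forall s t, s0 <= s <= s1 -> cdiff F (s, t)).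
  { intros s t Hst. unfold F. apply (cdiff_comp cexp f); [apply cdiff_cexp|]. apply Hf.
    rewrite Cmod_cexp; simpl. rewrite <- exp_0. apply exp_increasing. lra. }
  assert (PI0 := PI_RGT_0).
  assert (G := goursat F s0 s1 0 (2 * PI) ltac:(lra) ltac:(lra) ltac:(auto)).
  unfold contour in G.
  assert (Per : forall s, Im (F (s, 2 * PI)) = Im (F (s, 0))).
  { intros s. unfold F, cexp; simpl. rewrite cos_2PI, sin_2PI, cos_0, sin_0. auto. }
  rewrite (RInt_ext (fun s => Im (F (s, 2 * PI))) (fun s => Im (F (s, 0)))) in G by auto.
  assert (I : forall s, s0 <= s <= s1 -> ex_RInt (fun t => Re (F (s, t))) 0 (2 * PI)).
  { intros s Hst. apply @ex_RInt_continuous. intros z _.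
    apply (ccont_slices F s z). apply cdiff_ccont, HF; lra. }
  assert (U1 : RInt (fun t => Re (F (s1, t))) 0 (2 * PI) <= RInt (fun _ => M) 0 (2 * PI)).
  { apply RInt_le; [lra|apply I; lra|apply @ex_RInt_const|]. intros t _.
    eapply Rle_trans; [apply Re_le_Cmod|]. apply HM. rewrite Cmod_cexp; simpl. apply exp_ln; auto. }
  assert (U0 : RInt (fun _ => Re (f 0%C) - eps) 0 (2 * PI) <= RInt (fun t => Re (F (s0, t))) 0 (2 * PI)).
  { apply RInt_le; [lra|apply @ex_RInt_const|apply I; lra|]. intros t _.
    assert (B : Cmod (f (cexp (s0, t)) - f 0%C) < eps).
    { apply Hc. replace (cexp (s0, t) - 0)%C with (cexp (s0, t)) by ring.
      rewrite Cmod_cexp; simpl. unfold s0. rewrite exp_ln by auto. lra. }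
    generalize (Rabs_Re_le_Cmod (f (cexp (s0, t)) - f 0)%C).
    unfold F, Re; simpl. intros B2. assert (B3 := Rle_lt_trans _ _ _ B2 B).
    apply Rabs_def2 in B3. lra. }
  rewrite RInt_const in U1, U0. unfold scal in U1, U0; simpl in U1, U0. unfold mult in U1, U0; simpl in U1, U0.
  nra.
Qed.

(** Rotate [f] so that [f 0] becomes a positive real number. *)
Lemma mean_value_Cmod (f : C -> C) (r M : R) : hol f -> 0 < r < 1 ->
  (forall z, Cmod z = r -> Cmod (f z) <= M) -> Cmod (f 0%C) <= M.
Proof.
  intros Hf Hr HM.
  destruct (Ceq_dec (f 0%C) 0%C) as [E|n].
  { rewrite E, Cmod_0. eapply Rle_trans; [apply Cmod_ge_0|apply (HM (RtoC r))].
    rewrite Cmod_R. apply Rabs_pos_eq. lra. }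
  set (m := Cmod (f 0%C)). assert (Hm : 0 < m) by (apply Cmod_gt_0; auto).
  set (u := (Cconj (f 0%C) / RtoC m)%C).
  assert (Hmc : RtoC m <> 0%C) by (intros E; apply RtoC_inj in E; lra).
  assert (Hu : Cmod u = 1).
  { unfold u. rewrite Cmod_div by auto. rewrite Cmod_conj, Cmod_R. fold m.
    rewrite Rabs_pos_eq by lra. field. lra. }
  assert (E : (u * f 0)%C = RtoC m).
  { unfold u. replace (Cconj (f 0) / m * f 0)%C with (f 0 * Cconj (f 0) / m)%C by (field; auto).
    rewrite <- Cmod2_conj. fold m. rewrite <- RtoC_div by lra. f_equal. field. lra. }
  replace m with (Re (u * f 0)%C) by (rewrite E; auto).
  apply (mean_value_Re (fun z => u * f z)%C r M); auto.
  - intros z Hz. apply cdiff_mult; [apply cdiff_const|auto].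
  - intros z Hz. rewrite Cmod_mult, Hu, Rmult_1_l. auto.
Qed.

(** * The maximum principle and the Schwarz-Pick lemma *)

Definition mob (a z : C) : C := ((z + a) / (1 + Cconj a * z))%C.

Lemma sqr_le_inv (a b : R) : 0 <= b -> a ^ 2 <= b ^ 2 -> a <= b.
Proof. nra. Qed.

Lemma Cmod_lt_1_sqr (z : C) : Cmod z < 1 <-> Cmod z ^ 2 < 1.
Proof. generalize (Cmod_ge_0 z). split; nra. Qed.

Lemma mob_den_neq_0 (a z : C) : Cmod a < 1 -> Cmod z < 1 -> (1 + Cconj a * z)%C <> 0%C.
Proof.
  intros Ha Hz. apply Cmod_pos_neq.
  generalize (Cmod_plus_ge 1 (Cconj a * z)). rewrite Cmod_1, Cmod_mult, Cmod_conj.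
  generalize (Cmod_ge_0 a) (Cmod_ge_0 z). nra.
Qed.

Lemma mob_identity (a z : C) :
  Cmod (1 + Cconj a * z) ^ 2 - Cmod (z + a) ^ 2 = (1 - Cmod a ^ 2) * (1 - Cmod z ^ 2).
Proof. rewrite !Cmod2_alt. destruct a, z; unfold Re, Im; simpl. ring. Qed.

Lemma mob_Cmod2 (a z : C) : Cmod a < 1 -> Cmod z < 1 ->
  1 - Cmod (mob a z) ^ 2 = (1 - Cmod a ^ 2) * (1 - Cmod z ^ 2) / Cmod (1 + Cconj a * z) ^ 2.
Proof.
  intros Ha Hz. assert (N := mob_den_neq_0 a z Ha Hz).
  rewrite <- mob_identity. unfold mob. rewrite Cmod_div by auto.
  field. intros E. apply N. now apply Cmod_eq_0.
Qed.

Lemma mob_disc (a z : C) : Cmod a < 1 -> Cmod z < 1 -> Cmod (mob a z) < 1.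
Proof.
  intros Ha Hz. apply Cmod_lt_1_sqr.
  assert (0 < 1 - Cmod (mob a z) ^ 2); [|lra].
  rewrite mob_Cmod2 by auto. apply Rdiv_lt_0_compat.
  - apply Cmod_lt_1_sqr in Ha. apply Cmod_lt_1_sqr in Hz. nra.
  - apply pow_lt, Cmod_gt_0, mob_den_neq_0; auto.
Qed.

Lemma mob_cdiff (a z : C) : Cmod a < 1 -> Cmod z < 1 -> cdiff (mob a) z.
Proof.
  intros Ha Hz. unfold mob. apply cdiff_div.
  - apply cdiff_plus; [apply cdiff_id|apply cdiff_const].
  - apply cdiff_plus; [apply cdiff_const|]. apply cdiff_mult; [apply cdiff_const|apply cdiff_id].
  - now apply mob_den_neq_0.
Qed.

Lemma mob_0 (a : C) : mob a 0 = a.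
Proof. unfold mob. replace (1 + Cconj a * 0)%C with (RtoC 1) by ring. field. Qed.

Lemma mob_opp_self (a : C) : mob (- a) a = 0%C.
Proof. unfold mob. replace (a + - a)%C with (RtoC 0) by ring. unfold Cdiv. ring. Qed.

Lemma mob_mob_opp (a z : C) : Cmod a < 1 -> Cmod z < 1 -> mob a (mob (- a) z) = z.
Proof.
  intros Ha Hz. unfold mob.
  assert (N := mob_den_neq_0 (- a) z ltac:(rewrite Cmod_opp; auto) Hz).
  assert (N2 := mob_den_neq_0 (- a) a ltac:(rewrite Cmod_opp; auto) Ha).
  rewrite Copp_conj in *.
  assert (E : (1 + Cconj a * ((z + - a) / (1 + - Cconj a * z)))%C =
     ((1 + - Cconj a * a) / (1 + - Cconj a * z))%C) by (field; auto).
  rewrite E. field. repeat split; auto.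
Qed.

Lemma hol_comp (f g : C -> C) : hol f -> (forall z, Cmod z < 1 -> Cmod (f z) < 1) -> hol g ->
  hol (fun z => g (f z)).
Proof. intros Hf Hs Hg z Hz. apply (cdiff_comp f g); auto. Qed.

(** The mean value inequality only concerns the centre; the automorphism [mob a]
    brings any point [a] there, and preserves neighbourhoods of the unit circle. *)
Lemma maximum_modulus (f : C -> C) (r M : R) : hol f -> r < 1 ->
  (forall z, r <= Cmod z < 1 -> Cmod (f z) <= M) ->
  forall z, Cmod z < 1 -> Cmod (f z) <= M.
Proof.
  intros Hf Hr HM a Ha.
  rewrite <- (mob_0 a).
  set (r1 := Rmax r 0). assert (0 <= r1 < 1) by (unfold r1, Rmax; destruct Rle_dec; lra).
  assert (r <= r1) by apply Rmax_l. clearbody r1.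
  set (m := Cmod a) in *. assert (Hm : 0 <= m) by apply Cmod_ge_0.
  (* [t = 1 - s ^ 2] is so small that [mob a] maps the circle of radius [s]
     outside the disc of radius [r1]. *)
  set (t := (1 - r1 ^ 2) * (1 - m) / 2).
  assert (Ht : 0 < t < 1).
  { unfold t. assert (0 < (1 - r1 ^ 2)) by nra.
    split; [|nra]. assert (0 < (1 - r1 ^ 2) * (1 - m)) by (apply Rmult_lt_0_compat; lra). lra. }
  set (s := sqrt (1 - t)).
  assert (Hs2 : s ^ 2 = 1 - t) by (unfold s; rewrite pow2_sqrt; lra).
  assert (Hs0 : 0 < s) by (apply sqrt_lt_R0; lra).
  apply mean_value_Cmod with (f := fun z => f (mob a z)) (r := s).
  - apply hol_comp; auto. intros z Hz. now apply mob_cdiff. intros; now apply mob_disc.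
  - split; auto. nra.
  - intros z Hz. assert (Hz1 : Cmod z < 1) by nra. apply HM. split; [|now apply mob_disc].
    apply Rle_trans with r1; auto. apply sqr_le_inv; [apply Cmod_ge_0|].
    assert (E := mob_Cmod2 a z Ha Hz1). fold m in E. rewrite Hz, Hs2 in E.
    assert (D : 1 - m <= Cmod (1 + Cconj a * z)).
    { generalize (Cmod_plus_ge 1 (Cconj a * z)). rewrite Cmod_1, Cmod_mult, Cmod_conj. fold m. nra. }
    assert (F : 1 - Cmod (mob a z) ^ 2 <= 1 - r1 ^ 2); [|simpl in *; lra].
    rewrite E. apply Rle_div_l; [apply pow_lt; lra|].
    apply Rle_trans with ((1 - r1 ^ 2) * (1 - m) ^ 2).
    + replace (1 - (1 - t)) with ((1 - r1 ^ 2) * (1 - m) / 2) by (unfold t; ring).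
      assert (0 <= (1 - r1 ^ 2) * (1 - m) ^ 2) by (apply Rmult_le_pos; nra).
      replace ((1 - m ^ 2) * ((1 - r1 ^ 2) * (1 - m) / 2)) with
        ((1 - r1 ^ 2) * (1 - m) ^ 2 * ((1 + m) / 2)) by (field). nra.
    + apply Rmult_le_compat_l; [nra|]. apply pow_incr. lra.
Qed.

(** The usual quotient [q z = f z / z] is only known to be continuous at [0], where
    its differentiability would require the removable singularity theorem.  But
    [z * q z ^ m] is differentiable at [0], with derivative [q 0 ^ m].  The maximum
    principle for it gives [|z| * |q z| ^ m <= 1] for all [m], which forces
    [|q z| <= 1]. *)
Lemma schwarz (f : C -> C) : hol f -> (forall z, Cmod z < 1 -> Cmod (f z) <= 1) ->
  f 0%C = 0%C -> forall z, Cmod z < 1 -> Cmod (f z) <= Cmod z.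
Proof.
  intros Hf Hb H0 a Ha.
  destruct (Hf 0%C ltac:(rewrite Cmod_0; lra)) as [q [Hq Hq2]].
  assert (E : forall z, f z = (q z * z)%C).
  { intros z. generalize (Hq2 z). rewrite H0. intros E.
    replace (f z) with (f z - 0)%C by ring. rewrite E. ring. }
  assert (Hh : forall m, hol (fun z => z * q z ^ m)%C).
  { intros m z Hz. destruct (Ceq_dec z 0%C) as [->|n].
    - exists (fun w => q w ^ m)%C. split.
      + clear -Hq. induction m; simpl; [apply ccont_const|now apply ccont_mult].
      + intros w. ring.
    - apply cdiff_ext_loc with (fun w => w * (f w / w) ^ m)%C (Cmod z).
      + now apply Cmod_gt_0.
      + intros w Hw. f_equal. f_equal. rewrite E. field. intros ->.
        rewrite Cmod_minus_sym in Hw. replace (z - 0)%C with z in Hw by ring. lra.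
      + apply cdiff_mult; [apply cdiff_id|]. apply cdiff_pow. apply cdiff_div; auto. apply cdiff_id. }
  assert (B : forall m r, 0 < r < 1 -> Cmod a * Cmod (q a) ^ m <= (/ r) ^ m).
  { intros m r Hr. rewrite <- Cmod_pow, <- Cmod_mult.
    apply (maximum_modulus (fun z => z * q z ^ m)%C r); auto; [lra|].
    intros z Hz. rewrite Cmod_mult, Cmod_pow.
    assert (Cmod (q z) <= / r).
    { specialize (Hb z (proj2 Hz)). rewrite E, Cmod_mult in Hb.
      generalize (Cmod_ge_0 (q z)). intros Q.
      apply Rmult_le_reg_r with r; [lra|]. rewrite Rinv_l by lra. nra. }
    rewrite <- (Rmult_1_l ((/ r) ^ m)). apply Rmult_le_compat; try lra.
    + apply pow_le, Cmod_ge_0.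
    + apply pow_incr. split; auto. apply Cmod_ge_0. }
  destruct (Ceq_dec a 0%C) as [->|n]; [rewrite H0; lra|].
  assert (Pa : 0 < Cmod a) by now apply Cmod_gt_0.
  rewrite E, Cmod_mult.
  destruct (Rle_dec (Cmod (q a)) 1) as [L|L]; [nra|]. exfalso.
  apply Rnot_le_lt in L. set (k := Cmod (q a)) in *.
  (* A radius [r < 1] with [r * k > 1]: then the powers of [r * k] are unbounded. *)
  set (r := (k + 1) / 2 / k).
  assert (Hr : 0 < r < 1).
  { unfold r. split; [apply Rdiv_lt_0_compat; lra|]. apply Rlt_div_l; lra. }
  assert (Hrk : r * k = (k + 1) / 2) by (unfold r; field; lra).
  destruct (Pow_x_infinity (r * k)) with (b := 2 / Cmod a) as [N HN].
  { rewrite Rabs_pos_eq; rewrite Hrk; lra. }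
  specialize (HN N (Nat.le_refl N)). specialize (B N r Hr).
  rewrite Rabs_pos_eq in HN by (apply pow_le; rewrite Hrk; lra).
  assert (PN : 0 < r ^ N) by (apply pow_lt; lra).
  rewrite pow_inv in B.
  assert (B2 : Cmod a * (r * k) ^ N <= 1).
  { rewrite Rpow_mult_distr. apply Rmult_le_compat_l with (r := r ^ N) in B; [|lra].
    rewrite Rinv_r in B by lra. lra. }
  assert (2 <= Cmod a * (r * k) ^ N); [|lra].
  apply Rge_le in HN. apply Rle_div_l in HN; lra.
Qed.

(** The squared hyperbolic sine of half the hyperbolic distance, in the disc and in
    the right half-plane.  Unlike the distance, it is a rational expression in the
    moduli and real parts involved. *)
Definition sinh2_disc (a b : C) : R := Cmod (a - b) ^ 2 / ((1 - Cmod a ^ 2) * (1 - Cmod b ^ 2)).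
Definition sinh2_half (p q : C) : R := Cmod (p - q) ^ 2 / (4 * Re p * Re q).

Lemma disc_gap (a : C) : Cmod a < 1 -> 0 < 1 - Cmod a ^ 2.
Proof. intros H. apply Cmod_lt_1_sqr in H. lra. Qed.

Lemma sinh2_disc_nonneg a b : Cmod a < 1 -> Cmod b < 1 -> 0 <= sinh2_disc a b.
Proof.
  intros Ha Hb. apply disc_gap in Ha. apply disc_gap in Hb.
  unfold sinh2_disc. apply Rdiv_le_0_compat; [apply pow2_ge_0|nra].
Qed.

Lemma sinh2_disc_mob (a b : C) : Cmod a < 1 -> Cmod b < 1 ->
  sinh2_disc a b = Cmod (mob (- b) a) ^ 2 / (1 - Cmod (mob (- b) a) ^ 2).
Proof.
  intros Ha Hb. assert (Hb' : Cmod (- b) < 1) by (rewrite Cmod_opp; auto).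
  rewrite mob_Cmod2 by auto. unfold mob.
  assert (N := mob_den_neq_0 (- b) a Hb' Ha). assert (N2 := proj1 (Cmod_gt_0 _) N).
  rewrite Cmod_div by auto. rewrite Cmod_opp.
  apply disc_gap in Ha. apply disc_gap in Hb. unfold sinh2_disc.
  unfold Cminus. field. repeat split; lra.
Qed.

Lemma schwarz_pick (f : C -> C) (a b : C) : hol f -> (forall z, Cmod z < 1 -> Cmod (f z) < 1) ->
  Cmod a < 1 -> Cmod b < 1 -> sinh2_disc (f a) (f b) <= sinh2_disc a b.
Proof.
  intros Hf Hs Ha Hb.
  assert (Hfb : Cmod (- f b) < 1) by (rewrite Cmod_opp; auto).
  assert (Hb' : Cmod (- b) < 1) by (rewrite Cmod_opp; auto).
  rewrite !sinh2_disc_mob by auto.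
  set (z := mob (- b) a). assert (Hz : Cmod z < 1) by now apply mob_disc.
  assert (S : Cmod (mob (- f b) (f (mob b z))) <= Cmod z).
  { apply (schwarz (fun w => mob (- f b) (f (mob b w)))); auto.
    - intros w Hw. apply (cdiff_comp (fun w => f (mob b w)) (mob (- f b))).
      + apply (cdiff_comp (mob b) f); [now apply mob_cdiff|]. apply Hf. now apply mob_disc.
      + apply mob_cdiff; auto. apply Hs. now apply mob_disc.
    - intros w Hw. left. apply mob_disc; auto. apply Hs. now apply mob_disc.
    - rewrite mob_0. apply mob_opp_self. }
  unfold z in S at 1. rewrite mob_mob_opp in S by auto.
  set (s := Cmod (mob (- f b) (f a))) in *.
  assert (H0 : 0 <= s) by apply Cmod_ge_0.
  assert (Hs2 : s ^ 2 <= Cmod z ^ 2) by (apply pow_incr; lra).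
  apply disc_gap in Hz.
  unfold Rdiv. apply Rmult_le_compat; try nra.
  - left. apply Rinv_0_lt_compat. lra.
  - apply Rinv_le_contravar; lra.
Qed.

(** The map [p |-> (p - 1) / (p + 1)] is an isometry from the half-plane onto the
    disc. *)
Lemma schwarz_pick_half_plane (g : C -> C) (a b : C) : hol g ->
  (forall z, Cmod z < 1 -> 0 < Re (g z)) ->
  Cmod a < 1 -> Cmod b < 1 -> sinh2_half (g a) (g b) <= sinh2_disc a b.
Proof.
  intros Hg Hp Ha Hb.
  assert (N : forall p, 0 < Re p -> (p + 1)%C <> 0%C).
  { intros p H E. apply (f_equal Re) in E. unfold Re in *; simpl in E. lra. }
  assert (G : forall p, 0 < Re p -> 1 - Cmod ((p - 1) / (p + 1)) ^ 2 = 4 * Re p / Cmod (p + 1) ^ 2).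
  { intros p H. assert (N2 := proj1 (Cmod_gt_0 _) (N p H)). rewrite Cmod_div by auto.
    assert (E : Cmod (p + 1) ^ 2 = Cmod (p - 1) ^ 2 + 4 * Re p).
    { rewrite !Cmod2_alt. destruct p; unfold Re, Im; simpl. ring. }
    unfold Rdiv at 1. rewrite Rpow_mult_distr, pow_inv, E. field. rewrite <- E.
    apply pow_nonzero. lra. }
  set (k p := ((p - 1) / (p + 1))%C).
  assert (K1 : forall z, Cmod z < 1 -> Cmod (k (g z)) < 1).
  { intros z Hz. apply Cmod_lt_1_sqr. assert (P := Hp z Hz).
    assert (0 < 1 - Cmod (k (g z)) ^ 2); [|lra]. unfold k. rewrite G by auto.
    apply Rdiv_lt_0_compat; [lra|]. apply pow_lt, Cmod_gt_0. auto. }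
  replace (sinh2_half (g a) (g b)) with (sinh2_disc (k (g a)) (k (g b))).
  { apply (schwarz_pick (fun z => k (g z))); auto.
    intros z Hz. unfold k. apply cdiff_div; auto.
    - apply cdiff_minus; auto. apply cdiff_const.
    - apply cdiff_plus; auto. apply cdiff_const. }
  assert (Pa := Hp a Ha). assert (Pb := Hp b Hb).
  unfold sinh2_disc, sinh2_half. unfold k at 3 4. rewrite !G by auto.
  replace (k (g a) - k (g b))%C with (2 * (g a - g b) / ((g a + 1) * (g b + 1)))%C
    by (unfold k; field; auto).
  rewrite Cmod_div by (apply Cmult_neq_0; auto).
  rewrite !Cmod_mult, Cmod_R, Rabs_pos_eq by lra.
  assert (Na := proj1 (Cmod_gt_0 _) (N _ Pa)). assert (Nb := proj1 (Cmod_gt_0 _) (N _ Pb)).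
  field. repeat split; lra.
Qed.

(** * The Cayley transform and Julia's lemma *)

Definition cayley (tau z : C) : C := ((tau + z) / (tau - z))%C.

Lemma cayley_den (tau z : C) : Cmod tau = 1 -> Cmod z < 1 -> (tau - z)%C <> 0%C.
Proof. intros Ht Hz. apply Cmod_pos_neq. generalize (Cmod_minus_ge tau z). lra. Qed.

Lemma cayley_Re (tau z : C) : Cmod tau = 1 -> Cmod z < 1 ->
  Re (cayley tau z) = (1 - Cmod z ^ 2) / Cmod (tau - z) ^ 2.
Proof.
  intros Ht Hz. assert (N := cayley_den tau z Ht Hz). assert (P := proj1 (Cmod_gt_0 _) N).
  replace 1 with (Cmod tau ^ 2) by (rewrite Ht; ring).
  assert (P2 : Cmod (tau - z) ^ 2 <> 0) by (apply pow_nonzero; lra).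
  unfold cayley, Cdiv, Cinv. rewrite !Cmod2_alt in *.
  destruct tau as [x y], z as [u v]. unfold Re, Im in *; simpl in *. field.
  intros E. apply P2. rewrite <- E. ring.
Qed.

Lemma cayley_Re_pos (tau z : C) : Cmod tau = 1 -> Cmod z < 1 -> 0 < Re (cayley tau z).
Proof.
  intros Ht Hz. rewrite cayley_Re by auto. apply Rdiv_lt_0_compat; [now apply disc_gap|].
  apply pow_lt, Cmod_gt_0. now apply cayley_den.
Qed.

Lemma cayley_cdiff (tau z : C) : Cmod tau = 1 -> Cmod z < 1 -> cdiff (cayley tau) z.
Proof.
  intros Ht Hz. unfold cayley. apply cdiff_div.
  - apply cdiff_plus; [apply cdiff_const|apply cdiff_id].
  - apply cdiff_minus; [apply cdiff_const|apply cdiff_id].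
  - now apply cayley_den.
Qed.

Lemma cayley_isometry (tau a b : C) : Cmod tau = 1 -> Cmod a < 1 -> Cmod b < 1 ->
  sinh2_half (cayley tau a) (cayley tau b) = sinh2_disc a b.
Proof.
  intros Ht Ha Hb. unfold sinh2_half. rewrite !cayley_Re by auto.
  assert (Na := cayley_den tau a Ht Ha). assert (Nb := cayley_den tau b Ht Hb).
  replace (cayley tau a - cayley tau b)%C with (2 * tau * (a - b) / ((tau - a) * (tau - b)))%C
    by (unfold cayley; field; auto).
  rewrite Cmod_div by (apply Cmult_neq_0; auto).
  rewrite !Cmod_mult, Cmod_R, Rabs_pos_eq, Ht by lra.
  assert (Pa := proj1 (Cmod_gt_0 _) Na). assert (Pb := proj1 (Cmod_gt_0 _) Nb).
  apply disc_gap in Ha. apply disc_gap in Hb.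
  unfold sinh2_disc. field. repeat split; lra.
Qed.

Lemma cayley_inj (tau a b : C) : Cmod tau = 1 -> Cmod a < 1 -> Cmod b < 1 ->
  cayley tau a = cayley tau b -> a = b.
Proof.
  intros Ht Ha Hb E.
  assert (H := cayley_isometry tau a b Ht Ha Hb). rewrite E in H. unfold sinh2_half in H.
  rewrite Cmod_self_minus in H. unfold sinh2_disc in H. apply disc_gap in Ha. apply disc_gap in Hb.
  assert (Cmod (a - b) ^ 2 = 0).
  { replace (Cmod (a - b) ^ 2) with (Cmod (a - b) ^ 2 / ((1 - Cmod a ^ 2) * (1 - Cmod b ^ 2)) *
      ((1 - Cmod a ^ 2) * (1 - Cmod b ^ 2))) by (field; lra).
    rewrite <- H. unfold Rdiv. ring. }
  assert (Z : Cmod (a - b) = 0) by (generalize (Cmod_ge_0 (a - b)); nra).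
  apply Cmod_eq_0 in Z. replace a with (a - b + b)%C by ring. rewrite Z. ring.
Qed.

Lemma sinh2_disc_identity (a b : C) : Cmod a < 1 -> Cmod b < 1 ->
  Cmod (1 - Cconj a * b) ^ 2 = (1 + sinh2_disc a b) * ((1 - Cmod a ^ 2) * (1 - Cmod b ^ 2)).
Proof.
  intros Ha Hb. unfold sinh2_disc.
  assert (E : Cmod (1 - Cconj a * b) ^ 2 = Cmod (a - b) ^ 2 + (1 - Cmod a ^ 2) * (1 - Cmod b ^ 2)).
  { rewrite !Cmod2_alt. destruct a, b; unfold Re, Im; simpl. ring. }
  rewrite E. apply disc_gap in Ha. apply disc_gap in Hb. field. lra.
Qed.

Lemma Cmod_boundary (tau z : C) : Cmod tau = 1 -> Cmod (1 - Cconj tau * z) = Cmod (tau - z).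
Proof.
  intros Ht. replace (1 - Cconj tau * z)%C with (Cconj tau * (tau - z))%C.
  - rewrite Cmod_mult, Cmod_conj, Ht. ring.
  - replace (Cconj tau * (tau - z))%C with (tau * Cconj tau - Cconj tau * z)%C by ring.
    rewrite <- Cmod2_conj, Ht. replace (1 ^ 2) with 1 by ring. reflexivity.
Qed.

(** The sublevel sets of [1 / Re (cayley tau z)] are the horodiscs at [tau].  They are
    limits of hyperbolic discs whose centres [a] tend to [tau], and the Schwarz-Pick
    lemma for these discs passes to the limit: the ratio of [1 - |f a| ^ 2] to
    [1 - |a| ^ 2] records how the radius changes. *)
Lemma julia (f : C -> C) (tau : C) (A : R) : hol f -> (forall z, Cmod z < 1 -> Cmod (f z) < 1) ->
  Cmod tau = 1 -> 0 < A ->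
  (forall eps, 0 < eps -> exists a, Cmod a < 1 /\ Cmod (a - tau) < eps /\ Cmod (f a - tau) < eps /\
     1 - Cmod (f a) ^ 2 <= A * (1 - Cmod a ^ 2)) ->
  forall z, Cmod z < 1 -> Re (cayley tau z) <= A * Re (cayley tau (f z)).
Proof.
  intros Hf Hs Ht HA HJ z Hz. assert (Hfz := Hs z Hz).
  rewrite !cayley_Re by auto.
  assert (PX := proj1 (Cmod_gt_0 _) (cayley_den tau (f z) Ht Hfz)).
  assert (PY := proj1 (Cmod_gt_0 _) (cayley_den tau z Ht Hz)).
  set (X := Cmod (tau - f z)) in *. set (Y := Cmod (tau - z)) in *.
  assert (GP := disc_gap _ Hz). assert (GQ := disc_gap _ Hfz).
  set (P := 1 - Cmod z ^ 2) in *. set (Q := 1 - Cmod (f z) ^ 2) in *.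
  assert (Main : X ^ 2 * P <= A * Y ^ 2 * Q).
  { apply le_epsilon. intros e0 He0.
    (* [K * eps] bounds the error made in replacing both [a] and [f a] by [tau]. *)
    set (K := 2 * X * P + A * Q * (2 * Y + 1)).
    assert (HK : 0 < K).
    { unfold K. assert (0 < X * P) by nra. assert (0 < A * Q) by nra. nra. }
    set (eps := Rmin (Rmin X 1) (e0 / K)).
    assert (He : 0 < eps) by (repeat apply Rmin_pos; try lra; now apply Rdiv_lt_0_compat).
    assert (E1 : eps <= X /\ eps <= 1 /\ eps * K <= e0).
    { unfold eps. generalize (Rmin_l (Rmin X 1) (e0 / K)) (Rmin_r (Rmin X 1) (e0 / K)) (Rmin_l X 1) (Rmin_r X 1).
      intros. repeat split; try lra. apply Rle_div_r; lra. }
    clearbody eps. destruct E1 as (E1 & E2 & E3).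
    destruct (HJ eps He) as [a (Ha & Ha1 & Ha2 & Ha3)].
    assert (SP := schwarz_pick f a z Hf Hs Ha Hz).
    assert (I1 := sinh2_disc_identity a z Ha Hz). assert (I2 := sinh2_disc_identity (f a) (f z) (Hs a Ha) Hfz).
    fold P in I1. fold Q in I2.
    assert (Near : forall (b w : C), Cmod w < 1 -> Cmod (b - tau) < eps ->
       Rabs (Cmod (1 - Cconj b * w) - Cmod (tau - w)) <= eps).
    { intros b w Hw Hb. rewrite <- (Cmod_boundary tau w Ht).
      assert (D : Cmod ((1 - Cconj b * w) - (1 - Cconj tau * w)) <= eps).
      { replace ((1 - Cconj b * w) - (1 - Cconj tau * w))%C with (- (Cconj (b - tau) * w))%C
          by (rewrite Cminus_conj; ring).
        rewrite Cmod_opp, Cmod_mult, Cmod_conj. generalize (Cmod_ge_0 w) (Cmod_ge_0 (b - tau)). nra. }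
      generalize (Cmod_minus_ge (1 - Cconj b * w) (1 - Cconj tau * w)).
      generalize (Cmod_minus_ge (1 - Cconj tau * w) (1 - Cconj b * w)).
      rewrite (Cmod_minus_sym (1 - Cconj tau * w)). intros. apply Rabs_le. lra. }
    assert (N1 := Near a z Hz Ha1). assert (N2 := Near (f a) (f z) Hfz Ha2).
    fold X in N2. fold Y in N1.
    set (x := Cmod (1 - Cconj (f a) * f z)) in *. set (y := Cmod (1 - Cconj a * z)) in *.
    apply Rabs_le_between in N1. apply Rabs_le_between in N2.
    assert (Ga := disc_gap _ Ha). assert (Gfa := disc_gap _ (Hs a Ha)).
    set (p := 1 - Cmod a ^ 2) in *. set (q := 1 - Cmod (f a) ^ 2) in *.
    set (D1 := sinh2_disc a z) in *. set (D2 := sinh2_disc (f a) (f z)) in *.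
    assert (HD2 : 0 <= D2) by (apply sinh2_disc_nonneg; auto).
    assert (T : x ^ 2 * P <= A * y ^ 2 * Q).
    { rewrite I1, I2.
      apply Rle_trans with ((1 + D1) * (A * p * Q) * P); [|right; ring].
      apply Rmult_le_compat_r; [lra|]. apply Rmult_le_compat; nra. }
    assert (T1 : (X - eps) ^ 2 <= x ^ 2) by (apply pow_incr; lra).
    assert (T2 : y ^ 2 <= (Y + eps) ^ 2) by (apply pow_incr; split; [apply Cmod_ge_0|lra]).
    assert (T3 : (X - eps) ^ 2 * P <= A * (Y + eps) ^ 2 * Q).
    { apply Rle_trans with (x ^ 2 * P); [nra|]. eapply Rle_trans; [exact T|].
      apply Rmult_le_compat_r; [lra|]. apply Rmult_le_compat_l; lra. }
    assert (T4 : eps * K <= e0) by auto. unfold K in T4.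
    assert (0 <= eps ^ 2 * P) by (apply Rmult_le_pos; nra).
    assert (A * Q * eps ^ 2 <= A * Q * eps) by (apply Rmult_le_compat_l; nra).
    nra. }
  apply Rle_div_l; [apply pow_lt; lra|].
  replace (A * (Q / X ^ 2) * Y ^ 2) with (A * Y ^ 2 * Q / X ^ 2) by (field; lra).
  apply Rle_div_r; [apply pow_lt; lra|]. lra.
Qed.

(** * Hyperbolic maps expand the half-plane *)

Definition julia_expanding (f : C -> C) (tau : C) (lam : R) : Prop :=
  Cmod tau = 1 /\ 1 < lam /\
  forall z, Cmod z < 1 -> lam * Re (cayley tau z) <= Re (cayley tau (f z)).

(** One sequence tending to [tau], on which the boundary distance shrinks by a
    definite factor, is enough for expansion everywhere. *)
Lemma julia_expanding_of_contact (f : C -> C) (tau : C) (A : R) : hol f -> self_map f ->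
  Cmod tau = 1 -> 0 < A < 1 ->
  (forall eps, 0 < eps -> exists a, Cmod a < 1 /\ Cmod (a - tau) < eps /\ Cmod (f a - tau) < eps /\
     1 - Cmod (f a) ^ 2 <= A * (1 - Cmod a ^ 2)) ->
  julia_expanding f tau (/ A).
Proof.
  intros Hf Hs Ht HA H. split; [auto|]. split.
  - rewrite <- Rinv_1. apply Rinv_lt_contravar; lra.
  - intros z Hz. assert (J := julia f tau A Hf Hs Ht ltac:(lra) H z Hz).
    apply Rmult_le_reg_l with A; [lra|]. rewrite <- Rmult_assoc, Rinv_r by lra. lra.
Qed.

Lemma locally_Cmod (x : C) (P : C -> Prop) : locally x P ->
  exists d, 0 < d /\ forall y, Cmod (y - x) < d -> P y.
Proof.
  intros [d Hd]. exists d. split; [apply cond_pos|].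
  intros y Hy. apply Hd. apply (C_NormedModule_mixin_compat1 x y d). exact Hy.
Qed.

Lemma Cmod_locally (x : C) (e : R) : 0 < e -> locally x (fun y : C => Cmod (y - x) < e).
Proof.
  intros He. assert (S2 : 0 < sqrt 2) by (apply sqrt_lt_R0; lra).
  exists (mkposreal (e / sqrt 2) ltac:(now apply Rdiv_lt_0_compat)). intros y Hy.
  assert (B := C_NormedModule_mixin_compat2 x y _ Hy). simpl in B.
  replace (sqrt 2 * (e / sqrt 2)) with e in B by (field; lra). exact B.
Qed.

(** The radius ending at [tau] lies in the Stolz region of aperture [2]. *)
Lemma angular_lim_radial (f : C -> C) (tau l : C) : Cmod tau = 1 -> is_angular_lim f tau l ->
  forall eps, 0 < eps -> exists d, 0 < d < 1 /\ forall r, 1 - d < r < 1 -> Cmod (f (RtoC r * tau)%C - l) < eps.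
Proof.
  intros Ht H eps He. specialize (H 2 ltac:(lra) _ (Cmod_locally l eps He)).
  unfold filtermap, within in H. destruct (locally_Cmod _ _ H) as [d [Hd Hd2]].
  exists (Rmin d (1 / 2)). split.
  { split; [apply Rmin_pos; lra|]. generalize (Rmin_r d (1/2)). lra. }
  intros r Hr. generalize (Rmin_l d (1/2)) (Rmin_r d (1/2)). intros M1 M2.
  assert (E1 : Cmod (RtoC r * tau - tau) = 1 - r).
  { replace (RtoC r * tau - tau)%C with (RtoC (r - 1) * tau)%C by (rewrite RtoC_minus; ring).
    rewrite Cmod_mult, Ht, Cmod_R, Rabs_left by lra. ring. }
  assert (E2 : Cmod (RtoC r * tau) = r).
  { rewrite Cmod_mult, Ht, Cmod_R, Rabs_pos_eq by lra. ring. }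
  apply Hd2.
  - rewrite E1. lra.
  - split; unfold Defs.disc; [rewrite E2; lra|]. rewrite E2, (Cmod_minus_sym tau), E1. lra.
Qed.

Lemma hol_of_holomorphic (f : C -> C) : holomorphic_on_disc f -> hol f.
Proof. intros H z Hz. apply ex_derive_cdiff, H, Hz. Qed.

(** The angular limit [omega] in the definition of the angular derivative has first
    to be identified with [tau].  The iterates of [0] tend to the circle, so
    infinitely often the modulus does not decrease, and Julia's lemma with factor
    [1] shows that horodiscs at [tau] are invariant.  As the point [r * tau] lies in
    smaller and smaller horodiscs, [f (r * tau)] tends to [tau].  Then the angular
    derivative [a < 1] bounds the contact ratio along the radius by a number less
    than [1], and Julia's lemma is applied a second time. *)
Lemma hyperbolic_julia_expanding (f : C -> C) : hyperbolic f ->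
  exists tau lam, julia_expanding f tau lam.
Proof.
  intros [[Hh [Hs _]] (tau & a & [Ht HDW] & [omega [Hom Hder]] & Ha)].
  apply hol_of_holomorphic in Hh.
  set (x n := Nat.iter n f 0%C).
  assert (D0 : Defs.disc 0%C) by (unfold Defs.disc; rewrite Cmod_0; lra).
  assert (Hx : forall n, Cmod (x n) < 1) by (induction n; [exact D0|apply Hs; auto]).
  assert (Lim : forall eps, 0 < eps -> eventually (fun n => Cmod (x n - tau) < eps)).
  { destruct (HDW 0%C D0) as [r [Hr H]]. intros eps He. destruct (H eps He) as [N HN].
    exists N. intros n Hn. apply HN; auto. rewrite Cmod_self_minus. auto. }
  assert (J1 : forall z, Cmod z < 1 -> Re (cayley tau z) <= 1 * Re (cayley tau (f z))).
  { apply julia; auto; [lra|]. intros eps He. destruct (Lim eps He) as [N HN].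
    destruct (classic (exists n, (N <= n)%nat /\ Cmod (x n) <= Cmod (x (S n)))) as [[n [Hn Hn2]]|no].
    - exists (x n). repeat split; auto.
      + apply (HN (S n)). lia.
      + assert (Cmod (x n) ^ 2 <= Cmod (x (S n)) ^ 2) by (apply pow_incr; split; auto using Cmod_ge_0).
        change (f (x n)) with (x (S n)). lra.
    - exfalso. assert (Dec : forall k, Cmod (x (N + k)%nat) <= Cmod (x N)).
      { induction k; [rewrite Nat.add_0_r; lra|]. rewrite Nat.add_succ_r.
        destruct (Rle_dec (Cmod (x (N + k)%nat)) (Cmod (x (S (N + k))))) as [l|l]; [|lra].
        elim no. exists (N + k)%nat. split; [lia|auto]. }
      destruct (Lim (1 - Cmod (x N))) as [M HM]; [generalize (Hx N); lra|].
      specialize (HM (N + M)%nat ltac:(lia)). specialize (Dec M).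
      generalize (Cmod_minus_ge tau (x (N + M)%nat)). rewrite Cmod_minus_sym. lra. }
  assert (Rad : forall r, 0 < r < 1 -> Cmod (RtoC r * tau) = r /\ Cmod (tau - RtoC r * tau) = 1 - r).
  { intros r Hr. split.
    - rewrite Cmod_mult, Ht, Cmod_R, Rabs_pos_eq by lra. ring.
    - replace (tau - RtoC r * tau)%C with (RtoC (1 - r) * tau)%C by (rewrite RtoC_minus; ring).
      rewrite Cmod_mult, Ht, Cmod_R, Rabs_pos_eq by lra. ring. }
  assert (Cv : forall r, 0 < r < 1 -> Cmod (tau - f (RtoC r * tau)%C) ^ 2 <= 1 - r).
  { intros r Hr. destruct (Rad r Hr) as [R1 R2].
    assert (Hz : Cmod (RtoC r * tau) < 1) by lra.
    assert (J := J1 _ Hz). rewrite Rmult_1_l, !cayley_Re, R1, R2 in J by (auto; apply Hs; auto).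
    set (w := f (RtoC r * tau)%C) in *. assert (Hw : Cmod w < 1) by (apply Hs; auto).
    assert (P := proj1 (Cmod_gt_0 _) (cayley_den tau w Ht Hw)).
    replace ((1 - r ^ 2) / (1 - r) ^ 2) with ((1 + r) / (1 - r)) in J by (field; lra).
    apply (proj2 (Rle_div_r _ _ _ (pow_lt _ 2 P))) in J.
    set (k := Cmod (tau - w) ^ 2) in *. assert (0 < k) by (apply pow_lt; auto).
    assert (J3 : (1 + r) * k <= 1 * (1 - r)); [|nra].
    { apply (proj1 (Rle_div_l ((1 + r) * k) 1 (1 - r) ltac:(lra))).
      replace ((1 + r) * k / (1 - r)) with ((1 + r) / (1 - r) * k) by (field; lra).
      generalize (pow2_ge_0 (Cmod w)). lra. } }
  assert (Eom : omega = tau).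
  { destruct (Ceq_dec omega tau) as [|n]; auto. exfalso.
    assert (Pn := proj1 (Cmod_gt_0 _) (Cminus_neq_0 _ _ n)). set (e := Cmod (omega - tau)) in *.
    destruct (angular_lim_radial f tau omega Ht Hom (e / 2) ltac:(lra)) as [d [Hd H]].
    set (r := 1 - Rmin (d / 2) (e ^ 2 / 4)).
    assert (0 < e ^ 2 / 4) by nra.
    generalize (Rmin_l (d / 2) (e ^ 2 / 4)) (Rmin_r (d / 2) (e ^ 2 / 4)). intros M1 M2.
    assert (0 < Rmin (d / 2) (e ^ 2 / 4)) by (apply Rmin_pos; lra).
    specialize (H r ltac:(unfold r; lra)). specialize (Cv r ltac:(unfold r; lra)).
    assert (Cmod (tau - f (RtoC r * tau)%C) <= e / 2).
    { apply sqr_le_inv; [lra|]. eapply Rle_trans; [exact Cv|]. unfold r. lra. }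
    generalize (Cmod_triangle_minus omega (f (RtoC r * tau)%C) tau). fold e.
    rewrite (Cmod_minus_sym omega), (Cmod_minus_sym _ tau). lra. }
  subst omega.
  (* The slack between [a] and [(1 + a) / 2] absorbs the factor
     [(1 + |f z|) / (1 + |z|)], close to [1], that arises from squaring the moduli. *)
  exists tau, (/ ((1 + a) / 2)). apply julia_expanding_of_contact; auto; [lra|].
  intros eps He.
  destruct (angular_lim_radial _ tau (RtoC a) Ht Hder ((1 - a) / 4) ltac:(lra)) as [d [Hd H]].
  set (t := Rmin (Rmin (d / 2) (eps / 2)) ((1 - a) / 4)).
  assert (t <= d / 2 /\ t <= eps / 2 /\ t <= (1 - a) / 4) as (T1 & T2 & T3).
  { generalize (Rmin_l (Rmin (d / 2) (eps / 2)) ((1 - a) / 4)) (Rmin_r (Rmin (d / 2) (eps / 2)) ((1 - a) / 4))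
     (Rmin_l (d / 2) (eps / 2)) (Rmin_r (d / 2) (eps / 2)). fold t. lra. }
  assert (T0 : 0 < t) by (repeat apply Rmin_pos; lra). clearbody t.
  set (r := 1 - t). assert (Hr : 0 < r < 1) by (unfold r; lra).
  destruct (Rad r Hr) as [R1 R2]. specialize (H r ltac:(unfold r; lra)). cbv beta in H.
  assert (Hz : Cmod (RtoC r * tau) < 1) by lra.
  exists (RtoC r * tau)%C. set (z := (RtoC r * tau)%C) in *.
  assert (Hw : Cmod (f z) < 1) by (apply Hs; auto).
  assert (Hzt : Cmod (z - tau) = t) by (rewrite Cmod_minus_sym, R2; unfold r; ring).
  assert (B : Cmod (f z - tau) <= (1 + 3 * a) / 4 * t).
  { assert (Q : Cmod ((f z - tau) / (z - tau)) <= (1 + 3 * a) / 4).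
    { generalize (Cmod_minus_ge ((f z - tau) / (z - tau)) (RtoC a)). rewrite Cmod_R, Rabs_pos_eq by lra. lra. }
    rewrite Cmod_div in Q.
    - rewrite Hzt in Q. exact (proj1 (Rle_div_l _ _ _ T0) Q).
    - apply Cmod_pos_neq. rewrite Hzt. auto. }
  split; [auto|]. split; [rewrite Hzt; lra|]. split; [nra|].
  rewrite R1.
  assert (B2 : 1 - Cmod (f z) <= (1 + 3 * a) / 4 * t).
  { generalize (Cmod_minus_ge tau (f z)). rewrite (Cmod_minus_sym tau). lra. }
  set (m := Cmod (f z)) in *. unfold r.
  apply Rle_trans with ((1 + 3 * a) / 4 * t * 2).
  - generalize (Cmod_ge_0 (f z)). fold m. intros.
    replace (1 - m ^ 2) with ((1 - m) * (1 + m)) by ring. apply Rmult_le_compat; lra.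
  - replace ((1 + a) / 2 * (1 - (1 - t) ^ 2)) with (t * ((1 + a) / 2 * (2 - t))) by ring.
    replace ((1 + 3 * a) / 4 * t * 2) with (t * ((1 + 3 * a) / 2)) by field.
    apply Rmult_le_compat_l; [lra|]. nra.
Qed.

(** * Orbits of an expanding map *)

Lemma div_le_mul (a b c : R) : 0 < c -> a / c <= b -> a <= b * c.
Proof. intros Hc. apply (Rle_div_l a b c Hc). Qed.

Lemma le_div_mul (a b c : R) : 0 < c -> a <= b / c -> a * c <= b.
Proof. intros Hc. apply (Rle_div_r a b c Hc). Qed.

Lemma iter_disc (f : C -> C) (n : nat) (z : C) : self_map f -> Cmod z < 1 -> Cmod (Nat.iter n f z) < 1.
Proof. intros Hs Hz. induction n; simpl; auto. apply Hs; auto. Qed.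

Lemma iter_commute (f g : C -> C) (n : nat) (z : C) : self_map f ->
  (forall z, Cmod z < 1 -> f (g z) = g (f z)) -> Cmod z < 1 ->
  Nat.iter n f (g z) = g (Nat.iter n f z).
Proof.
  intros Hs Hc Hz. induction n; simpl; auto. rewrite IHn. apply Hc. now apply iter_disc.
Qed.

Lemma iter_schwarz_pick (f : C -> C) (n : nat) (a b : C) : hol f -> self_map f ->
  Cmod a < 1 -> Cmod b < 1 -> sinh2_disc (Nat.iter n f a) (Nat.iter n f b) <= sinh2_disc a b.
Proof.
  intros Hf Hs Ha Hb. induction n; simpl; [lra|]. eapply Rle_trans; [|exact IHn].
  apply schwarz_pick; auto using iter_disc.
Qed.

Section Orbits.

Variables (f : C -> C) (tau : C) (lam : R).
Hypothesis Hf : hol f.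
Hypothesis Hs : self_map f.
Hypothesis HJ : julia_expanding f tau lam.

Local Notation w n z := (cayley tau (Nat.iter n f z)).

Lemma orbit_Re_pos n z : Cmod z < 1 -> 0 < Re (w n z).
Proof using Hs HJ. intros Hz. apply cayley_Re_pos; [apply HJ|]. now apply iter_disc. Qed.

Lemma orbit_growth n z : Cmod z < 1 -> lam ^ n * Re (w 0 z) <= Re (w n z).
Proof using Hs HJ.
  intros Hz. destruct HJ as (Ht & Hl & J). induction n; [simpl; lra|].
  specialize (J (Nat.iter n f z) (iter_disc _ _ _ Hs Hz)).
  change (Nat.iter (S n) f z) with (f (Nat.iter n f z)).
  rewrite <- tech_pow_Rmult. nra.
Qed.

Lemma orbit_infinite z M : Cmod z < 1 -> exists N, forall n, (N <= n)%nat -> M <= Re (w n z).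
Proof using Hs HJ.
  intros Hz. assert (P := orbit_Re_pos 0 z Hz). destruct HJ as (Ht & Hl & J).
  destruct (Pow_x_infinity lam) with (b := M / Re (w 0 z)) as [N HN].
  { rewrite Rabs_pos_eq; lra. }
  exists N. intros n Hn. specialize (HN n Hn).
  rewrite Rabs_pos_eq in HN by (apply pow_le; lra). apply Rge_le in HN.
  apply (proj1 (Rle_div_l _ _ _ P)) in HN. generalize (orbit_growth n z Hz). lra.
Qed.

(** Consecutive points of the orbit stay at bounded hyperbolic distance, so a step
    is at most a constant times the real part reached.  As real parts grow
    geometrically, the sum of the steps is controlled by the last real part. *)
Lemma orbit_nontangential z : Cmod z < 1 -> exists B, 0 < B /\ forall n, Cmod (w n z) <= B * Re (w n z).
Proof using Hf Hs HJ.
  intros Hz. assert (P0 := orbit_Re_pos 0 z Hz).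
  assert (Hfz : Cmod (f z) < 1) by (apply Hs; auto).
  set (K := sinh2_disc (f z) z). assert (HK : 0 <= K) by now apply sinh2_disc_nonneg.
  assert (Hl : 1 < lam) by apply HJ.
  set (B0 := Cmod (w 0 z) / Re (w 0 z)).
  assert (HB0 : 0 <= B0) by (apply Rdiv_le_0_compat; auto using Cmod_ge_0).
  (* [B1] is the fixed point of [B |-> B / lam + 2 * (K + 1)], the recursion obeyed by
     the bound on [|w n| / Re (w n)]; [2 * (K + 1)] bounds the relative step. *)
  set (B1 := 2 * (K + 1) * lam / (lam - 1)).
  assert (HB1 : 0 < B1) by (apply Rdiv_lt_0_compat; nra).
  exists (B0 + B1). split; [lra|].
  induction n.
  - apply Rle_trans with (B0 * Re (w 0 z)); [|nra].
    right. unfold B0. field. lra.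
  - assert (Pn := orbit_Re_pos n z Hz). assert (Pn1 := orbit_Re_pos (S n) z Hz).
    assert (G : lam * Re (w n z) <= Re (w (S n) z)).
    { apply HJ. now apply iter_disc. }
    assert (St : sinh2_half (w (S n) z) (w n z) <= K).
    { rewrite cayley_isometry; [|apply HJ|now apply iter_disc|now apply iter_disc].
      rewrite Nat.iter_succ_r. now apply iter_schwarz_pick. }
    unfold sinh2_half in St. apply div_le_mul in St; [|nra].
    assert (D : Cmod (w (S n) z - w n z) <= 2 * (K + 1) * Re (w (S n) z)).
    { apply sqr_le_inv; [nra|]. eapply Rle_trans; [exact St|].
      set (p := Re (w (S n) z)) in *. set (r := Re (w n z)) in *.
      assert (r <= p) by nra. assert (K <= (K + 1) ^ 2) by nra.
      apply Rle_trans with (K * (4 * p * p)); [apply Rmult_le_compat_l; nra|].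
      replace ((2 * (K + 1) * p) ^ 2) with ((K + 1) ^ 2 * (4 * p * p)) by ring.
      apply Rmult_le_compat_r; nra. }
    assert (T : Cmod (w (S n) z) <= Cmod (w (S n) z - w n z) + Cmod (w n z)).
    { generalize (Cmod_minus_ge (w (S n) z) (w n z)). lra. }
    set (p := Re (w (S n) z)) in *. set (r := Re (w n z)) in *.
    assert (E : (B0 + B1) * r <= (B0 + B1) / lam * p).
    { replace ((B0 + B1) / lam * p) with ((B0 + B1) * (p / lam)) by (field; lra).
      apply Rmult_le_compat_l; [lra|]. apply Rle_div_r; lra. }
    assert (E2 : 2 * (K + 1) + (B0 + B1) / lam <= B0 + B1).
    { assert (E3 : B1 / lam + 2 * (K + 1) = B1) by (unfold B1; field; lra).
      assert (B0 / lam <= B0) by (apply Rle_div_l; nra).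
      replace ((B0 + B1) / lam) with (B0 / lam + B1 / lam) by (field; lra). lra. }
    nra.
Qed.

(** The orbit of [u] is asymptotic to [c] times the orbit of [v].  The error is
    measured by the real part, which for these orbits is comparable to the modulus;
    with this choice the relation composes and also controls hyperbolic
    distances.  It is the substitute for [sigma u = c * sigma v] with [sigma] the
    Koenigs function of [f]. *)
Definition asymptotic (c : R) (u v : C) : Prop := forall eps, 0 < eps ->
  exists N, forall n, (N <= n)%nat ->
    Cmod (cayley tau (Nat.iter n f u) - RtoC c * cayley tau (Nat.iter n f v)) <=
      eps * Re (cayley tau (Nat.iter n f v)).

(** The Julia-Caratheodory theorem along orbits.  Let [c] be the infimum of
    [Re W (g z) / Re (W z)].  The function [W (g z) - c * W z] takes values in the
    closed half-plane, and at some point [b] its real part is as small as desired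
    relative to [Re (W b)].  The Schwarz-Pick lemma with base point [b] spreads this
    smallness to the whole orbit, because the latter is non-tangential. *)
Lemma julia_caratheodory (g : C -> C) : hol g -> self_map g ->
  exists c, 0 <= c /\ forall z, Cmod z < 1 -> forall eps, 0 < eps ->
  exists N, forall n, (N <= n)%nat ->
    Cmod (cayley tau (g (Nat.iter n f z)) - RtoC c * w n z) <= eps * Re (w n z).
Proof using Hf Hs HJ.
  intros Hg Hgs. assert (Ht : Cmod tau = 1) by apply HJ.
  assert (D0 : Cmod 0%C < 1) by (rewrite Cmod_0; lra).
  assert (PW : forall z, Cmod z < 1 -> 0 < Re (cayley tau z)) by (intros; now apply cayley_Re_pos).
  set (E c := forall z, Cmod z < 1 -> c * Re (cayley tau z) <= Re (cayley tau (g z))).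
  destruct (completeness E) as [c [Uc Lc]].
  { exists (Re (cayley tau (g 0%C)) / Re (cayley tau 0)). intros c Hc.
    apply Rle_div_r; [now apply PW|]. now apply Hc. }
  { exists 0. intros z Hz. rewrite Rmult_0_l. left. apply PW, Hgs, Hz. }
  assert (c0 : 0 <= c).
  { apply Uc. intros z Hz. rewrite Rmult_0_l. left. apply PW, Hgs, Hz. }
  assert (Ec : E c).
  { intros z Hz. apply Rle_div_r; [now apply PW|]. apply Lc. intros c' Hc'.
    apply Rle_div_r; [now apply PW|]. now apply Hc'. }
  exists c. split; auto. intros z Hz eps He.
  destruct (orbit_nontangential z Hz) as [B [HB NT]].
  set (e := eps / (8 * B ^ 2 + 1)).
  assert (HB2 : 0 < B ^ 2) by nra.
  assert (Hee : 0 < e) by (apply Rdiv_lt_0_compat; lra).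
  assert (NE : ~ E (c + e)) by (intros H; apply Uc in H; lra).
  apply not_all_ex_not in NE. destruct NE as [b NE].
  apply imply_to_and in NE. destruct NE as [Hb NE]. apply Rnot_le_lt in NE.
  set (beta := cayley tau b) in *. assert (Pb : 0 < Re beta) by now apply PW.
  set (eta := e * Re beta). assert (Heta : 0 < eta) by (apply Rmult_lt_0_compat; auto).
  (* Adding [eta] makes the real part positive without spoiling its smallness at [b]. *)
  set (h z := (cayley tau (g z) - RtoC c * cayley tau z + RtoC eta)%C).
  assert (Hh : hol h).
  { intros x Hx. unfold h. apply cdiff_plus; [|apply cdiff_const]. apply cdiff_minus.
    - apply (cdiff_comp g (cayley tau)); auto. apply cayley_cdiff; auto. apply Hgs; auto.
    - apply cdiff_mult; [apply cdiff_const|]. apply cayley_cdiff; auto. }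
  assert (Reh : forall x, Re (h x) = Re (cayley tau (g x)) - c * Re (cayley tau x) + eta).
  { intros x. unfold h, Re; simpl. ring. }
  assert (Ph : forall x, Cmod x < 1 -> 0 < Re (h x)).
  { intros x Hx. rewrite Reh. generalize (Ec x Hx). lra. }
  assert (Yb : Re (h b) <= 2 * eta).
  { rewrite Reh. unfold eta. fold beta. lra. }
  assert (Pyb := Ph b Hb).
  destruct (orbit_infinite z (Cmod beta) Hz) as [N1 HN1].
  destruct (orbit_infinite z ((2 * eta + Cmod (h b) + eta) / e) Hz) as [N2 HN2].
  exists (N1 + N2)%nat. intros n Hn.
  specialize (HN1 n ltac:(lia)). specialize (HN2 n ltac:(lia)). specialize (NT n).
  set (x := Nat.iter n f z) in *. assert (Hx : Cmod x < 1) by now apply iter_disc.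
  set (om := cayley tau x) in *. assert (Pom : 0 < Re om) by now apply PW.
  assert (SP := schwarz_pick_half_plane h x b Hh Ph Hx Hb).
  rewrite <- (cayley_isometry tau x b Ht Hx Hb) in SP. fold om beta in SP.
  unfold sinh2_half in SP. assert (Px := Ph x Hx).
  set (d := Cmod (h x - h b)) in *. set (y := Re (h b)) in *.
  set (T := Cmod (om - beta) ^ 2 / (Re om * Re beta)).
  assert (HT0 : 0 <= T) by (apply Rdiv_le_0_compat; [apply pow2_ge_0|nra]).
  assert (Hd0 : 0 <= d) by apply Cmod_ge_0.
  assert (SP2 : d ^ 2 <= T * Re (h x) * y).
  { replace (Cmod (om - beta) ^ 2 / (4 * Re om * Re beta)) with (T / 4) in SP by (unfold T; field; lra).
    apply div_le_mul in SP; [|nra]. lra. }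
  assert (Hrx : Re (h x) <= d + y).
  { generalize (Re_le_Cmod (h x - h b)). fold d. unfold y. unfold Re; simpl. lra. }
  assert (Hd1 : d <= y * (T + 1)).
  { apply Rnot_lt_le. intros L.
    assert (d ^ 2 <= T * (d + y) * y).
    { eapply Rle_trans; [exact SP2|]. apply Rmult_le_compat_r; [lra|]. apply Rmult_le_compat_l; lra. }
    assert (y * T <= d) by nra. assert (0 <= y * T) by nra. nra. }
  assert (Hob : Cmod (om - beta) <= 2 * B * Re om).
  { eapply Rle_trans; [apply Cmod_minus_le|].
    assert (Re om <= Cmod om) by apply Re_le_Cmod. lra. }
  assert (HT : T * Re beta <= 4 * B ^ 2 * Re om).
  { unfold T. replace (Cmod (om - beta) ^ 2 / (Re om * Re beta) * Re beta) with
      (Cmod (om - beta) ^ 2 / Re om) by (field; lra).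
    apply Rle_div_l; [lra|].
    apply Rle_trans with ((2 * B * Re om) ^ 2); [apply pow_incr; split; auto using Cmod_ge_0|].
    right; ring. }
  assert (F1 : d <= 2 * eta + 8 * B ^ 2 * e * Re om).
  { eapply Rle_trans; [exact Hd1|].
    apply Rle_trans with (2 * eta * (T + 1)); [apply Rmult_le_compat_r; lra|].
    unfold eta. nra. }
  apply (proj1 (Rle_div_l _ _ _ Hee)) in HN2.
  replace (cayley tau (g x) - RtoC c * om)%C with ((h x - h b) + (h b - RtoC eta))%C
    by (unfold h; fold om; ring).
  eapply Rle_trans; [apply Cmod_triangle|]. fold d.
  assert (F2 : Cmod (h b - RtoC eta) <= Cmod (h b) + eta).
  { eapply Rle_trans; [apply Cmod_minus_le|]. rewrite Cmod_R, Rabs_pos_eq; lra. }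
  assert (F3 : eps = e * (8 * B ^ 2 + 1)) by (unfold e; field; lra).
  rewrite F3. nra.
Qed.

Lemma asymptotic_trans c c' u v t : 0 <= c -> 0 <= c' -> Cmod v < 1 -> Cmod t < 1 ->
  asymptotic c u v -> asymptotic c' v t -> asymptotic (c * c') u t.
Proof using Hs HJ.
  intros Hc Hc' Hv Ht A1 A2 eps He.
  assert (e1 : 0 < eps / (2 * (c' + 1))) by (apply Rdiv_lt_0_compat; lra).
  assert (e2 : 0 < Rmin 1 (eps / (2 * (c + 1)))) by (apply Rmin_pos; [lra|apply Rdiv_lt_0_compat; lra]).
  destruct (A1 _ e1) as [N1 H1]. destruct (A2 _ e2) as [N2 H2].
  exists (N1 + N2)%nat. intros n Hn. specialize (H1 n ltac:(lia)). specialize (H2 n ltac:(lia)).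
  assert (Pv := orbit_Re_pos n v Hv). assert (Pt := orbit_Re_pos n t Ht).
  set (U := cayley tau (Nat.iter n f u)) in *. set (V := cayley tau (Nat.iter n f v)) in *.
  set (T := cayley tau (Nat.iter n f t)) in *.
  generalize (Rmin_l 1 (eps / (2 * (c + 1)))) (Rmin_r 1 (eps / (2 * (c + 1)))).
  set (m := Rmin 1 (eps / (2 * (c + 1)))) in *. intros M1 M2.
  assert (M3 : m * (2 * (c + 1)) <= eps) by (apply le_div_mul; lra).
  set (k := eps / (2 * (c' + 1))) in *.
  assert (K3 : k * (2 * (c' + 1)) = eps) by (unfold k; field; lra).
  assert (RV : Re V <= (c' + 1) * Re T).
  { assert (R : Re V - c' * Re T <= Cmod (V - RtoC c' * T)).
    { eapply Rle_trans; [|apply Re_le_Cmod]. unfold Re; simpl. right; ring. }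
    nra. }
  replace (U - RtoC (c * c') * T)%C with ((U - RtoC c * V) + RtoC c * (V - RtoC c' * T))%C
    by (rewrite RtoC_mult; ring).
  eapply Rle_trans; [apply Cmod_triangle|]. rewrite Cmod_mult, Cmod_R, Rabs_pos_eq by lra.
  apply Rle_trans with (k * ((c' + 1) * Re T) + c * (m * Re T)).
  - apply Rplus_le_compat; [|apply Rmult_le_compat_l; lra].
    eapply Rle_trans; [exact H1|]. apply Rmult_le_compat_l; lra.
  - assert (c * m <= eps / 2) by nra.
    assert (k * (c' + 1) = eps / 2) by lra. nra.
Qed.

Lemma asymptotic_sym c u v : 0 < c -> Cmod u < 1 -> Cmod v < 1 ->
  asymptotic c u v -> asymptotic (/ c) v u.
Proof using Hs HJ.
  intros Hc Hu Hv A eps He.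
  assert (Hcc : RtoC c <> 0%C) by (intros E; apply RtoC_inj in E; lra).
  assert (K0 : 0 < eps * c ^ 2 / 2) by (assert (0 < c ^ 2) by nra; nra).
  destruct (A (Rmin (c / 2) (eps * c ^ 2 / 2)) ltac:(apply Rmin_pos; lra)) as [N H].
  exists N. intros n Hn. specialize (H n Hn).
  assert (Pu := orbit_Re_pos n u Hu). assert (Pv := orbit_Re_pos n v Hv).
  set (U := cayley tau (Nat.iter n f u)) in *. set (V := cayley tau (Nat.iter n f v)) in *.
  generalize (Rmin_l (c / 2) (eps * c ^ 2 / 2)) (Rmin_r (c / 2) (eps * c ^ 2 / 2)).
  set (m := Rmin (c / 2) (eps * c ^ 2 / 2)) in *. intros M1 M2.
  replace (V - RtoC (/ c) * U)%C with (- ((U - RtoC c * V) / RtoC c))%C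
    by (rewrite RtoC_inv by lra; field; auto).
  rewrite Cmod_opp, Cmod_div, Cmod_R, Rabs_pos_eq by (auto; lra).
  assert (R : c * Re V - Re U <= Cmod (U - RtoC c * V)).
  { rewrite <- Cmod_opp. eapply Rle_trans; [|apply Re_le_Cmod]. unfold Re; simpl. right; ring. }
  apply Rle_div_l; [lra|]. eapply Rle_trans; [exact H|].
  assert (m * Re V <= c / 2 * Re V) by (apply Rmult_le_compat_r; lra).
  assert (m * Re V <= eps * c ^ 2 / 2 * Re V) by (apply Rmult_le_compat_r; lra).
  assert (0 < eps * c) by nra.
  assert (eps * c * (c * Re V) <= eps * c * (2 * Re U)) by (apply Rmult_le_compat_l; lra). nra.
Qed.

Lemma close_of_sinh2_half p q eta : 0 < Re p -> 0 < Re q -> 0 <= eta <= 1 / 4 -> sinh2_half p q <= eta ^ 2 ->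
  Cmod (p - q) <= 4 * eta * Re q.
Proof using.
  intros Hp Hq He H. unfold sinh2_half in H.
  apply div_le_mul in H; [|nra].
  assert (R : Re p - Re q <= Cmod (p - q)).
  { eapply Rle_trans; [|apply Re_le_Cmod]. unfold Re; simpl. right; ring. }
  set (x := Cmod (p - q)) in *. set (r := Re q) in *. assert (0 <= x) by apply Cmod_ge_0.
  apply Rnot_lt_le. intros L.
  assert (A1 : x ^ 2 <= 4 * eta ^ 2 * (x * r) + 4 * eta ^ 2 * (r * r)).
  { eapply Rle_trans; [exact H|]. assert (0 <= eta ^ 2) by nra.
    replace (eta ^ 2 * (4 * Re p * r)) with (4 * eta ^ 2 * (Re p * r)) by ring.
    replace (4 * eta ^ 2 * (x * r) + 4 * eta ^ 2 * (r * r)) with (4 * eta ^ 2 * ((x + r) * r)) by ring.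
    apply Rmult_le_compat_l; [lra|]. apply Rmult_le_compat_r; lra. }
  assert (Hx : 0 < x) by nra.
  assert (A2 : 4 * eta ^ 2 * (r * r) <= eta * r * x).
  { replace (4 * eta ^ 2 * (r * r)) with (eta * r * (4 * eta * r)) by ring.
    apply Rmult_le_compat_l; nra. }
  assert (A3 : 4 * eta ^ 2 * (x * r) <= eta * (x * r)) by (apply Rmult_le_compat_r; nra).
  assert (A4 : 4 * eta * r * x < x ^ 2) by nra.
  assert (0 <= eta * r * x) by (apply Rmult_le_pos; nra). nra.
Qed.

(** The Schwarz-Pick lemma for [f^n], read at infinity: the points [c * w] and [w]
    of the half-plane are at distance at least [|log c|], and so are [u] and [v].  For
    [c = 0] the inequality is absurd. *)
Lemma asymptotic_separation c u v : Cmod u < 1 -> Cmod v < 1 ->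
  asymptotic c u v -> (c - 1) ^ 2 <= 4 * c * sinh2_disc u v.
Proof using Hf Hs HJ.
  intros Hu Hv A. set (D := sinh2_disc u v). assert (HD : 0 <= D) by now apply sinh2_disc_nonneg.
  apply le_epsilon. intros e He.
  set (K := 2 * Rabs (c - 1) + 1 + 4 * D). assert (HK : 0 < K) by (unfold K; generalize (Rabs_pos (c - 1)); lra).
  assert (M0 : 0 < Rmin 1 (e / K)) by (apply Rmin_pos; [lra|now apply Rdiv_lt_0_compat]).
  generalize (Rmin_l 1 (e / K)) (Rmin_r 1 (e / K)).
  set (m := Rmin 1 (e / K)) in *. intros M1 M2.
  assert (M3 : m * K <= e) by (apply le_div_mul; lra).
  destruct (A m M0) as [n Hn]. specialize (Hn n (Nat.le_refl n)).
  assert (SP := iter_schwarz_pick f n u v Hf Hs Hu Hv). fold D in SP.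
  rewrite <- (cayley_isometry tau) in SP; [|apply HJ|now apply iter_disc|now apply iter_disc].
  assert (Pu := orbit_Re_pos n u Hu). assert (Pv := orbit_Re_pos n v Hv).
  set (U := cayley tau (Nat.iter n f u)) in *. set (V := cayley tau (Nat.iter n f v)) in *.
  unfold sinh2_half in SP. apply div_le_mul in SP; [|nra].
  set (s := Re U / Re V). assert (Es : Re U = s * Re V) by (unfold s; field; lra).
  assert (R1 : Rabs (Re U - c * Re V) <= m * Re V).
  { eapply Rle_trans; [|exact Hn]. eapply Rle_trans; [|apply Rabs_Re_le_Cmod].
    right. f_equal. unfold Re; simpl. ring. }
  assert (R2 : (Re U - Re V) ^ 2 <= D * (4 * Re U * Re V)).
  { eapply Rle_trans; [|exact SP]. rewrite <- (Rabs_pos_eq ((Re U - Re V) ^ 2)) by apply pow2_ge_0.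
    rewrite <- RPow_abs. apply pow_incr. split; [apply Rabs_pos|].
    eapply Rle_trans; [|apply Rabs_Re_le_Cmod]. right. f_equal. }
  assert (S1 : (s - 1) ^ 2 <= 4 * s * D).
  { apply Rmult_le_reg_r with (Re V ^ 2); [nra|]. rewrite Es in R2. nra. }
  assert (S2 : Rabs (s - c) <= m).
  { apply Rmult_le_reg_r with (Re V); auto. rewrite <- (Rabs_pos_eq (Re V)) at 1 by lra.
    rewrite <- Rabs_mult. eapply Rle_trans; [|exact R1]. right. f_equal. rewrite Es. ring. }
  assert (S3 : (c - 1) ^ 2 <= (s - 1) ^ 2 + m * (2 * Rabs (c - 1) + 1)).
  { replace ((c - 1) ^ 2) with ((s - 1) ^ 2 + (c - s) * (2 * (c - 1) + (s - c))) by ring.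
    apply Rplus_le_compat_l. eapply Rle_trans; [apply Rle_abs|]. rewrite Rabs_mult.
    rewrite (Rabs_minus_sym c s). apply Rmult_le_compat; auto using Rabs_pos.
    eapply Rle_trans; [apply Rabs_triang|]. rewrite Rabs_mult, (Rabs_pos_eq 2) by lra. lra. }
  apply Rabs_le_between in S2.
  assert (4 * s * D <= 4 * c * D + m * (4 * D)) by nra.
  unfold K in M3. nra.
Qed.

(** Since [f^n (g z) = g (f^n z)], the Julia-Caratheodory theorem compares the orbits
    of [g z] and [z]; the constant is positive by [asymptotic_separation]. *)
Lemma commuting_multiplier (g : C -> C) : hol g -> self_map g ->
  (forall z, Cmod z < 1 -> f (g z) = g (f z)) ->
  exists c, 0 < c /\ forall z, Cmod z < 1 -> asymptotic c (g z) z.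
Proof using Hf Hs HJ.
  intros Hg Hgs Hc. destruct (julia_caratheodory g Hg Hgs) as [c [Hc0 JC]].
  assert (A : forall z, Cmod z < 1 -> asymptotic c (g z) z).
  { intros z Hz eps He. destruct (JC z Hz eps He) as [N HN]. exists N. intros n Hn.
    rewrite (iter_commute f g) by auto. now apply HN. }
  exists c. split; auto. destruct Hc0 as [|E]; auto. subst c. exfalso.
  assert (D0 : Cmod 0%C < 1) by (rewrite Cmod_0; lra).
  generalize (asymptotic_separation 0 _ _ (Hgs _ D0) D0 (A _ D0)). lra.
Qed.

End Orbits.

(** * Cluster points *)

Definition frequently (P : nat -> Prop) := forall N, exists n, (N <= n)%nat /\ P n.

(** The cluster point is a limit superior.  The property [P] depends on the tolerance
    [e] so that the lemma can be applied to the imaginary parts of a sequence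
    restricted to the indices where the real parts are already within [e] of their
    cluster point. *)
Lemma real_cluster (P : R -> nat -> Prop) (r : nat -> R) (M : R) :
  (forall n, Rabs (r n) <= M) ->
  (forall e e' n, e <= e' -> P e n -> P e' n) ->
  (forall e, 0 < e -> frequently (P e)) ->
  exists l, forall e, 0 < e -> frequently (fun n => P e n /\ Rabs (r n - l) < e).
Proof.
  intros HM Hmono HP.
  set (E b := forall e, 0 < e -> frequently (fun n => P e n /\ b <= r n)).
  destruct (completeness E) as [l [Ul Ll]].
  { exists M. intros b Hb. destruct (Hb 1 ltac:(lra) O) as [n [_ [_ Hn]]].
    generalize (Rle_abs (r n)) (HM n). lra. }
  { exists (- M). intros e He N. destruct (HP e He N) as [n [Hn Hp]]. exists n. repeat split; auto.
    specialize (HM n). apply Rabs_le_between in HM. lra. }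
  exists l. intros e He N.
  assert (Hb : exists b, E b /\ l - e < b).
  { apply NNPP. intros no. assert (l <= l - e); [|lra]. apply Ll. intros b Hb.
    apply Rnot_lt_le. intros L. apply no. now exists b. }
  destruct Hb as [b [Hb Hlb]].
  assert (Hn : ~ E (l + e / 2)) by (intros H; apply Ul in H; lra).
  apply not_all_ex_not in Hn. destruct Hn as [e1 Hn].
  apply imply_to_and in Hn. destruct Hn as [He1 Hn].
  apply not_all_ex_not in Hn. destruct Hn as [N1 Hn].
  destruct (Hb (Rmin e e1) ltac:(now apply Rmin_pos) (N + N1)%nat) as [n [Hn1 [Hp Hbn]]].
  exists n. split; [lia|]. split; [apply (Hmono (Rmin e e1)); auto; apply Rmin_l|].
  assert (r n < l + e / 2).
  { apply Rnot_le_lt. intros L. apply Hn. exists n. split; [lia|]. split; auto.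
    apply (Hmono (Rmin e e1)); auto; apply Rmin_r. }
  apply Rabs_def1; lra.
Qed.

Lemma complex_cluster (P : nat -> Prop) (x : nat -> C) (M : R) :
  (forall n, Cmod (x n) <= M) -> frequently P ->
  exists z : C, forall e, 0 < e -> frequently (fun n => P n /\ Cmod (x n - z) < e).
Proof.
  intros HM HP.
  destruct (real_cluster (fun _ n => P n) (fun n => fst (x n)) M) as [l1 H1]; auto.
  { intros n. eapply Rle_trans; [apply Rabs_Re_le_Cmod|auto]. }
  destruct (real_cluster (fun e n => P n /\ Rabs (fst (x n) - l1) < e) (fun n => snd (x n)) M) as [l2 H2]; auto.
  { intros n. eapply Rle_trans; [apply Rabs_Im_le_Cmod|auto]. }
  { intros e e' n He [Hp Hx]. split; auto. lra. }
  exists (l1, l2). intros e He N. destruct (H2 (e / 2) ltac:(lra) N) as [n [Hn [[Hp Hx] Hy]]].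
  exists n. split; auto. split; auto.
  eapply Rle_lt_trans; [apply Cmod_le_abs|]. simpl. unfold Rminus in *. lra.
Qed.

(** * Roots of non-vanishing functions *)

Lemma Csqrt_ex (z : C) : exists s : C, (s * s)%C = z /\ 0 <= Re s.
Proof.
  destruct z as [x y]. set (m := Cmod (x, y)).
  assert (Hm2 : m * m = x * x + y * y).
  { unfold m. generalize (Cmod2_alt (x, y)). unfold Re, Im; simpl. lra. }
  assert (Hmx : Rabs x <= m) by apply (Rabs_Re_le_Cmod (x, y)).
  apply Rabs_le_between in Hmx.
  set (a := sqrt ((m + x) / 2)). set (b := sqrt ((m - x) / 2)).
  assert (Ha : a * a = (m + x) / 2) by (apply sqrt_sqrt; lra).
  assert (Hb : b * b = (m - x) / 2) by (apply sqrt_sqrt; lra).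
  assert (Ha0 : 0 <= a) by apply sqrt_pos. assert (Hb0 : 0 <= b) by apply sqrt_pos.
  assert (Hab : 2 * (a * b) = Rabs y).
  { apply Rsqr_inj; [nra|apply Rabs_pos|]. rewrite <- Rsqr_abs. unfold Rsqr.
    replace (2 * (a * b) * (2 * (a * b))) with (4 * ((a * a) * (b * b))) by ring. rewrite Ha, Hb.
    replace (4 * ((m + x) / 2 * ((m - x) / 2))) with (m * m - x * x) by field. lra. }
  destruct (Rle_dec 0 y) as [Hy|Hy].
  - exists (a, b). split; [|exact Ha0]. rewrite Rabs_pos_eq in Hab by auto.
    unfold Cmult; simpl. f_equal; lra.
  - exists (a, - b). split; [|exact Ha0]. rewrite Rabs_left in Hab by lra.
    unfold Cmult; simpl. f_equal; lra.
Qed.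

Definition csqrt (z : C) : C := proj1_sig (constructive_indefinite_description _ (Csqrt_ex z)).

Lemma csqrt_spec z : (csqrt z * csqrt z)%C = z /\ 0 <= Re (csqrt z).
Proof. unfold csqrt. destruct constructive_indefinite_description; auto. Qed.

Lemma csqrt_cdiff (z : C) : 0 < Re z -> cdiff csqrt z.
Proof.
  intros Hz. destruct (csqrt_spec z) as [E Hp].
  assert (Hp2 : 0 < Re (csqrt z)).
  { destruct Hp as [|E0]; auto. exfalso. rewrite <- E, re_mult, <- E0 in Hz. nra. }
  set (s := csqrt z) in *.
  assert (Den : forall w, Re s <= Cmod (csqrt w + s)).
  { intros w. eapply Rle_trans; [|apply Re_le_Cmod]. rewrite re_plus.
    generalize (proj2 (csqrt_spec w)). lra. }
  assert (N : forall w, (csqrt w + s)%C <> 0%C).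
  { intros w. apply Cmod_pos_neq. generalize (Den w). lra. }
  assert (Q : forall w, (csqrt w - s)%C = (/ (csqrt w + s) * (w - z))%C).
  { intros w. rewrite <- E at 1. rewrite <- (proj1 (csqrt_spec w)) at 3. field. auto. }
  exists (fun w => / (csqrt w + s))%C. split; [|exact Q].
  apply (ccont_comp (fun w => csqrt w + s)%C Cinv); [|now apply ccont_Cinv].
  apply ccont_plus; [|apply ccont_const].
  intros e He. exists (e * Re s). split; [nra|]. intros w Hw. fold s.
  rewrite Q, Cmod_mult, Cmod_inv by auto. generalize (Den w). intros D.
  rewrite Rmult_comm. apply Rlt_div_l; [lra|].
  assert (e * Re s <= e * Cmod (csqrt w + s)) by (apply Rmult_le_compat_l; lra). lra.
Qed.

Definition hol_on (a : C) (rho : R) (f : C -> C) := forall z, Cmod (z - a) < rho -> cdiff f z.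

Lemma schwarz_ball (f : C -> C) (a x : C) (rho : R) : hol_on a rho f ->
  (forall z, Cmod (z - a) < rho -> Cmod (f z) <= 1) -> Cmod (x - a) < rho ->
  Cmod (f x - f a) <= 2 / rho * Cmod (x - a).
Proof.
  intros Hf Hb Hx. assert (HR : 0 < rho) by (generalize (Cmod_ge_0 (x - a)); lra).
  assert (HRc : RtoC rho <> 0%C) by (intros E; apply RtoC_inj in E; lra).
  assert (H2c : RtoC 2 <> 0%C) by (intros E; apply RtoC_inj in E; lra).
  assert (In : forall w, Cmod w < 1 -> Cmod (a + RtoC rho * w - a) < rho).
  { intros w Hw. replace (a + RtoC rho * w - a)%C with (RtoC rho * w)%C by ring.
    rewrite Cmod_mult, Cmod_R, Rabs_pos_eq by lra. nra. }
  assert (Ha : Cmod (f a) <= 1) by (apply Hb; rewrite Cmod_self_minus; auto).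
  set (g w := ((f (a + RtoC rho * w) - f a) / RtoC 2)%C).
  assert (S := schwarz g).
  assert (Hw : Cmod ((x - a) / RtoC rho) < 1).
  { rewrite Cmod_div, Cmod_R, Rabs_pos_eq by (auto; lra). apply Rlt_div_l; lra. }
  specialize (fun A B D => S A B D _ Hw).
  assert (Eg : g ((x - a) / RtoC rho)%C = ((f x - f a) / RtoC 2)%C).
  { unfold g. do 3 f_equal. field. auto. }
  rewrite Eg, !Cmod_div, !Cmod_R, !Rabs_pos_eq in S by (auto; lra).
  assert (L : Cmod (f x - f a) / 2 <= Cmod (x - a) / rho).
  { apply S.
    - intros w Hw'. unfold g. apply cdiff_div; [|apply cdiff_const|auto].
      apply cdiff_minus; [|apply cdiff_const]. apply (cdiff_comp (fun w => a + RtoC rho * w)%C f).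
      + apply cdiff_plus; [apply cdiff_const|]. apply cdiff_mult; [apply cdiff_const|apply cdiff_id].
      + apply Hf, In, Hw'.
    - intros w Hw'. unfold g. rewrite Cmod_div, Cmod_R, Rabs_pos_eq by (auto; lra).
      apply Rle_div_l; [lra|]. eapply Rle_trans; [apply Cmod_minus_le|].
      specialize (Hb _ (In w Hw')). lra.
    - unfold g. replace (a + RtoC rho * 0)%C with a by ring. field. }
  replace (2 / rho * Cmod (x - a)) with (2 * (Cmod (x - a) / rho)) by (field; lra). lra.
Qed.

(** Compactness of the closed ball of radius [rho']. *)
Lemma nonvanishing_lower_bound (f : C -> C) (a : C) (rho rho' : R) : rho' < rho -> hol_on a rho f ->
  (forall z, Cmod (z - a) < rho -> f z <> 0%C) ->
  exists m, 0 < m /\ forall z, Cmod (z - a) <= rho' -> m <= Cmod (f z).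
Proof.
  intros HR Hf Hn. apply NNPP. intros no.
  assert (S : forall n : nat, exists z, Cmod (z - a) <= rho' /\ Cmod (f z) < / (INR n + 1)).
  { intros n. apply NNPP. intros no2. apply no. exists (/ (INR n + 1)).
    split; [apply Rinv_0_lt_compat; generalize (pos_INR n); lra|].
    intros z Hz. apply Rnot_lt_le. intros L. apply no2. now exists z. }
  set (x n := proj1_sig (constructive_indefinite_description _ (S n))).
  assert (Hx : forall n, Cmod (x n - a) <= rho' /\ Cmod (f (x n)) < / (INR n + 1)).
  { intros n. unfold x. destruct constructive_indefinite_description; auto. }
  destruct (complex_cluster (fun _ => True) x (rho' + Cmod a)) as [z Hz].
  { intros n. generalize (Cmod_minus_ge (x n) a) (proj1 (Hx n)). lra. }
  { intros N. exists N. auto. }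
  assert (Hza : Cmod (z - a) < rho).
  { destruct (Hz (rho - rho') ltac:(lra) O) as [n [_ [_ Hn']]].
    generalize (Cmod_triangle_minus z (x n) a) (proj1 (Hx n)). rewrite (Cmod_minus_sym z (x n)). lra. }
  assert (P := proj1 (Cmod_gt_0 _) (Hn z Hza)). set (k := Cmod (f z)) in *.
  destruct (cdiff_ccont _ _ (Hf z Hza) (k / 2) ltac:(lra)) as [d [Hd Hc]].
  destruct (INR_unbounded (2 / k)) as [N HN].
  destruct (Hz d Hd N) as [n [Hn' [_ Hnz]]]. specialize (Hc _ Hnz). destruct (Hx n) as [_ Hfx].
  assert (/ (INR n + 1) < k / 2).
  { replace (k / 2) with (/ (2 / k)) by (field; lra).
    assert (0 < 2 / k) by (apply Rdiv_lt_0_compat; lra).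
    apply le_INR in Hn'. apply Rinv_lt_contravar; [|lra]. nra. }
  generalize (Cmod_minus_ge (f z) (f (x n))). rewrite (Cmod_minus_sym (f z)). fold k. lra.
Qed.

(** Along the segment from [a] to [z] cut into [N] pieces, [f z / f a] is the product of
    the ratios of [f] at consecutive points.  For [N] large each ratio lies in the
    right half-plane, where the principal root is holomorphic.  Only the modulus of
    the root is prescribed, so the constant factor can be taken real. *)
Lemma holomorphic_sqrt (f : C -> C) (a : C) (rho rho' : R) : 0 < rho' < rho -> hol_on a rho f ->
  (forall z, Cmod (z - a) < rho -> Cmod (f z) <= 1) ->
  (forall z, Cmod (z - a) < rho -> f z <> 0%C) ->
  exists g, hol_on a rho' g /\ forall z, Cmod (z - a) < rho' -> Cmod (g z) ^ 2 = Cmod (f z).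
Proof.
  intros HR Hf Hb Hn.
  destruct (nonvanishing_lower_bound f a rho rho' ltac:(lra) Hf Hn) as [m [Hm Hm2]].
  set (K := 2 / (rho - rho')). assert (HK : 0 < K) by (apply Rdiv_lt_0_compat; lra).
  destruct (INR_unbounded (rho' / (rho - rho') + K * rho' / m + 1)) as [N HN].
  assert (P1 : 0 < rho' / (rho - rho')) by (apply Rdiv_lt_0_compat; lra).
  assert (P2 : 0 < K * rho' / m) by (apply Rdiv_lt_0_compat; nra).
  set (h := / INR N). assert (HN0 : 0 < INR N) by lra.
  assert (Hh : 0 < h) by now apply Rinv_0_lt_compat.
  assert (HhN : h * INR N = 1) by (unfold h; field; lra).
  assert (Q1 : h * rho' < rho - rho').
  { unfold h. rewrite Rmult_comm. apply Rlt_div_l; auto.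
    assert (rho' = rho' / (rho - rho') * (rho - rho')) by (field; lra). nra. }
  assert (Q2 : K * (h * rho') < m).
  { replace (K * (h * rho')) with (K * rho' / INR N) by (unfold h; field; lra). apply Rlt_div_l; auto.
    assert (K * rho' = K * rho' / m * m) by (field; lra). nra. }
  set (p (i : nat) (z : C) := (a + RtoC (INR i * h) * (z - a))%C).
  assert (Hp : forall i z, (i <= N)%nat -> Cmod (z - a) < rho' -> Cmod (p i z - a) < rho').
  { intros i z Hi Hz. unfold p. replace (a + RtoC (INR i * h) * (z - a) - a)%C with
      (RtoC (INR i * h) * (z - a))%C by ring.
    rewrite Cmod_mult, Cmod_R. apply le_INR in Hi. generalize (pos_INR i). intros.
    rewrite Rabs_pos_eq by nra. assert (INR i * h <= 1) by nra.
    generalize (Cmod_ge_0 (z - a)). nra. }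
  assert (Hpd : forall i z, cdiff (p i) z).
  { intros i z. unfold p. apply cdiff_plus; [apply cdiff_const|].
    apply cdiff_mult; [apply cdiff_const|]. apply cdiff_minus; [apply cdiff_id|apply cdiff_const]. }
  set (ratio i z := (f (p (S i) z) / f (p i z))%C).
  assert (Hratio : forall i z, (i < N)%nat -> Cmod (z - a) < rho' -> cdiff (ratio i) z /\ 0 < Re (ratio i z)).
  { intros i z Hi Hz.
    assert (A1 := Hp i z ltac:(lia) Hz). assert (A2 := Hp (S i) z ltac:(lia) Hz).
    assert (Nz : f (p i z) <> 0%C) by (apply Hn; lra).
    split.
    - unfold ratio. apply cdiff_div; auto.
      + apply (cdiff_comp (p (S i)) f); [apply Hpd|]. apply Hf; lra.
      + apply (cdiff_comp (p i) f); [apply Hpd|]. apply Hf; lra.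
    - assert (D : Cmod (p (S i) z - p i z) < h * rho').
      { unfold p. rewrite S_INR. replace (a + RtoC ((INR i + 1) * h) * (z - a) - (a + RtoC (INR i * h) * (z - a)))%C
          with (RtoC h * (z - a))%C by (rewrite !RtoC_mult, RtoC_plus; ring).
        rewrite Cmod_mult, Cmod_R, Rabs_pos_eq by lra. nra. }
      assert (L : Cmod (f (p (S i) z) - f (p i z)) <= K * Cmod (p (S i) z - p i z)).
      { apply schwarz_ball; [| |lra].
        - intros w Hw. apply Hf. generalize (Cmod_triangle_minus w (p i z) a). lra.
        - intros w Hw. apply Hb. generalize (Cmod_triangle_minus w (p i z) a). lra. }
      assert (M := Hm2 (p i z) ltac:(lra)).
      assert (B : Cmod (1 - ratio i z) < 1).
      { unfold ratio. replace (1 - f (p (S i) z) / f (p i z))%C with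
          (- ((f (p (S i) z) - f (p i z)) / f (p i z)))%C by (field; auto).
        rewrite Cmod_opp, Cmod_div by auto. apply Rlt_div_l; [lra|]. nra. }
      assert (1 - Re (ratio i z) <= Cmod (1 - ratio i z)); [|lra].
      eapply Rle_trans; [|apply Re_le_Cmod]. right. unfold Re; simpl. ring. }
  set (g := fix g (i : nat) (z : C) : C := match i with
    | O => RtoC (sqrt (Cmod (f a)))
    | S j => (g j z * csqrt (ratio j z))%C end).
  assert (Hg : forall i, (i <= N)%nat -> hol_on a rho' (g i) /\
     forall z, Cmod (z - a) < rho' -> Cmod (g i z) ^ 2 = Cmod (f (p i z))).
  { induction i; intros Hi.
    - split; [intros z _; apply cdiff_const|]. intros z Hz. simpl g.
      rewrite Cmod_R, pow2_abs, pow2_sqrt by apply Cmod_ge_0.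
      unfold p. f_equal. f_equal. simpl INR. rewrite Rmult_0_l. ring.
    - destruct (IHi ltac:(lia)) as [I1 I2]. split.
      + intros z Hz. destruct (Hratio i z Hi Hz) as [H1 H2]. simpl g.
        apply cdiff_mult; [now apply I1|]. apply (cdiff_comp (ratio i) csqrt); auto.
        now apply csqrt_cdiff.
      + intros z Hz. change (g (S i) z) with (g i z * csqrt (ratio i z))%C.
        assert (Nz : f (p i z) <> 0%C) by (apply Hn; specialize (Hp i z ltac:(lia) Hz); lra).
        assert (Pz := proj1 (Cmod_gt_0 _) Nz).
        rewrite Cmod_mult, Rpow_mult_distr, I2 by auto.
        replace (Cmod (csqrt (ratio i z)) ^ 2) with (Cmod (csqrt (ratio i z) * csqrt (ratio i z)))
          by (rewrite Cmod_mult; ring).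
        rewrite (proj1 (csqrt_spec _)). unfold ratio. rewrite Cmod_div by auto. field. lra. }
  exists (g N). destruct (Hg N (Nat.le_refl N)) as [G1 G2]. split; auto.
  intros z Hz. rewrite G2 by auto. f_equal. f_equal. unfold p.
  replace (INR N * h) with 1 by lra. ring.
Qed.

(** A quantitative form of Hurwitz's theorem.  A function bounded by [1] whose value at
    [a] is at most [1/4] is at most [1/2] near [a], by the Schwarz lemma.  A
    non-vanishing function has roots of order [2 ^ k], to which this applies. *)
Lemma nonvanishing_decay (k : nat) : forall (f : C -> C) (a x : C) (rho : R), hol_on a rho f ->
  (forall z, Cmod (z - a) < rho -> Cmod (f z) <= 1) ->
  (forall z, Cmod (z - a) < rho -> f z <> 0%C) ->
  8 * Cmod (x - a) < rho -> Cmod (f a) <= (1 / 4) ^ (2 ^ k) -> Cmod (f x) <= (1 / 2) ^ (2 ^ k).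
Proof.
  induction k; intros f a x rho Hf Hb Hn Hx Ha; assert (X0 := Cmod_ge_0 (x - a)).
  - simpl in *. assert (S := schwarz_ball f a x rho Hf Hb ltac:(lra)).
    assert (2 / rho * Cmod (x - a) <= 1 / 4).
    { replace (2 / rho * Cmod (x - a)) with (2 * Cmod (x - a) / rho) by (field; lra). apply Rle_div_l; lra. }
    generalize (Cmod_minus_ge (f x) (f a)). lra.
  - set (rho' := (8 * Cmod (x - a) + rho) / 2).
    destruct (holomorphic_sqrt f a rho rho') as [g [G1 G2]]; auto; [unfold rho'; lra|].
    assert (In : forall z, Cmod (z - a) < rho' -> Cmod (z - a) < rho) by (unfold rho'; intros; lra).
    assert (Ca : Cmod (a - a) < rho') by (rewrite Cmod_self_minus; unfold rho'; lra).
    assert (Cx : Cmod (x - a) < rho') by (unfold rho'; lra).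
    assert (Ex : forall t, t ^ (2 ^ S k) = (t ^ (2 ^ k)) ^ 2).
    { intros t. rewrite <- pow_mult. f_equal. simpl. lia. }
    rewrite Ex in *. rewrite <- (G2 x Cx). apply pow_incr. split; [apply Cmod_ge_0|].
    apply (IHk g a x rho'); auto.
    + intros z Hz. apply sqr_le_inv; [lra|]. rewrite G2 by auto. rewrite pow1. auto.
    + intros z Hz E. apply (Hn z (In z Hz)). apply Cmod_eq_0. rewrite <- G2, E, Cmod_0 by auto. ring.
    + unfold rho'. lra.
    + apply sqr_le_inv; [apply pow_le; lra|]. rewrite G2; auto.
Qed.

Lemma nonvanishing_decay_eps (eps : R) : 0 < eps -> exists del, 0 < del /\
  forall (f : C -> C) (a x : C) (rho : R), hol_on a rho f ->
  (forall z, Cmod (z - a) < rho -> Cmod (f z) <= 1) ->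
  (forall z, Cmod (z - a) < rho -> f z <> 0%C) ->
  8 * Cmod (x - a) < rho -> Cmod (f a) <= del -> Cmod (f x) <= eps.
Proof.
  intros He. destruct (pow_lt_1_zero (1 / 2)) with (y := eps) as [k Hk]; auto.
  { rewrite Rabs_pos_eq; lra. }
  exists ((1 / 4) ^ (2 ^ k)). split; [apply pow_lt; lra|].
  intros f a x rho H1 H2 H3 H4 H5.
  eapply Rle_trans; [apply (nonvanishing_decay k f a x rho); auto|].
  specialize (Hk (2 ^ k)%nat). rewrite Rabs_pos_eq in Hk by (apply pow_le; lra).
  left. apply Hk. apply Nat.lt_le_incl, Nat.pow_gt_lin_r. lia.
Qed.

(** * Merging orbits start at the same point *)

Lemma interval_connected (P : R -> Prop) : P 0 ->
  (forall t, 0 <= t <= 1 -> P t -> exists d, 0 < d /\ forall s, 0 <= s <= 1 -> Rabs (s - t) < d -> P s) ->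
  (forall t, 0 <= t <= 1 -> (forall d, 0 < d -> exists s, 0 <= s <= 1 /\ Rabs (s - t) < d /\ P s) -> P t) ->
  P 1.
Proof.
  intros P0 Op Cl.
  set (E t := 0 <= t <= 1 /\ forall s, 0 <= s <= t -> P s).
  assert (E0 : E 0) by (split; [lra|]; intros s Hs; replace s with 0 by lra; auto).
  destruct (completeness E) as [T [UT LT]].
  { exists 1. intros t [Ht _]. lra. }
  { now exists 0. }
  assert (HT0 : 0 <= T) by now apply UT.
  assert (HT1 : T <= 1) by (apply LT; intros t [Ht _]; lra).
  assert (Ap : forall d, 0 < d -> exists t, E t /\ T - d < t).
  { intros d Hd. apply NNPP. intros no. assert (T <= T - d); [|lra]. apply LT. intros t Ht.
    apply Rnot_lt_le. intros L. apply no. now exists t. }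
  assert (PT : P T).
  { apply Cl; [lra|]. intros d Hd. destruct (Ap d Hd) as [t [Ht Hdt]].
    assert (t <= T) by now apply UT. exists t. destruct Ht as [Ht1 Ht2]. split; [auto|]. split.
    - apply Rabs_def1; lra.
    - apply Ht2; lra. }
  destruct (Op T ltac:(lra) PT) as [d [Hd Hd2]].
  set (t1 := Rmin (T + d / 2) 1).
  assert (t1 <= T + d / 2) by apply Rmin_l. assert (t1 <= 1) by apply Rmin_r.
  assert (T <= t1) by (apply Rmin_glb; lra).
  assert (Et : E t1).
  { split; [lra|]. intros s Hs. destruct (Rlt_dec s T) as [L|L].
    - destruct (Ap (T - s) ltac:(lra)) as [t [[Ht1 Ht2] Hdt]]. apply Ht2. lra.
    - apply Hd2; [lra|]. apply Rabs_def1; lra. }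
  apply Et. assert (t1 <= T) by now apply UT.
  unfold t1, Rmin in *. destruct Rle_dec; lra.
Qed.

Lemma hol_iter (f : C -> C) (n : nat) : hol f -> self_map f -> hol (Nat.iter n f).
Proof.
  intros Hf Hs. induction n; intros z Hz; simpl; [apply cdiff_id|].
  apply (cdiff_comp (Nat.iter n f) f); [now apply IHn|]. apply Hf. now apply iter_disc.
Qed.

Lemma iter_injective (f : C -> C) (n : nat) (a b : C) : self_map f -> injective_on_disc f ->
  Cmod a < 1 -> Cmod b < 1 -> Nat.iter n f a = Nat.iter n f b -> a = b.
Proof.
  intros Hs Hi Ha Hb. induction n; simpl; auto.
  intros E. apply IHn. apply Hi; auto; now apply iter_disc.
Qed.

Lemma Cmod_conj_plus_identity (p q : C) : Cmod (p + Cconj q) ^ 2 = Cmod (p - q) ^ 2 + 4 * Re p * Re q.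
Proof. rewrite !Cmod2_alt. destruct p, q; unfold Re, Im; simpl. ring. Qed.

Section Hurwitz.

Variables (f : C -> C) (tau : C) (lam : R).
Hypothesis Hf : hol f.
Hypothesis Hs : self_map f.
Hypothesis Hi : injective_on_disc f.
Hypothesis HJ : julia_expanding f tau lam.

Notation merging := (asymptotic f tau 1).

Lemma merging_refl u : Cmod u < 1 -> merging u u.
Proof using Hs HJ.
  intros Hu eps He. exists O. intros n _. rewrite Cmult_1_l, Cmod_self_minus.
  assert (P := orbit_Re_pos f tau lam Hs HJ n u Hu). nra.
Qed.

Lemma merging_sym u v : Cmod u < 1 -> Cmod v < 1 -> merging u v -> merging v u.
Proof using Hs HJ.
  intros Hu Hv A. assert (A' := asymptotic_sym f tau lam Hs HJ 1 u v Rlt_0_1 Hu Hv A).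
  now rewrite Rinv_1 in A'.
Qed.

Lemma merging_trans u v t : Cmod v < 1 -> Cmod t < 1 -> merging u v -> merging v t -> merging u t.
Proof using Hs HJ.
  intros Hv Ht A1 A2.
  assert (A := asymptotic_trans f tau lam Hs HJ 1 1 u v t Rle_0_1 Rle_0_1 Hv Ht A1 A2).
  now rewrite Rmult_1_l in A.
Qed.

(** The pseudo-hyperbolic distance from [f^n x] to [f^n b] is the modulus of a
    holomorphic function of [x] bounded by [1], which vanishes only at [b] because [f]
    is injective.  It tends to [0] at [a], hence near [a]. *)
Lemma merging_local a b : Cmod a < 1 -> Cmod b < 1 -> a <> b -> merging a b ->
  exists r, 0 < r /\ forall x, Cmod x < 1 -> Cmod (x - a) < r -> merging x b.
Proof using Hf Hs Hi HJ.
  intros Ha Hb Hab A. assert (Ht : Cmod tau = 1) by apply HJ.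
  assert (Pab := proj1 (Cmod_gt_0 _) (Cminus_neq_0 _ _ Hab)).
  (* The largest radius keeping the ball around [a] inside the disc and away from [b]. *)
  set (rho := Rmin (1 - Cmod a) (Cmod (a - b))).
  assert (Hr : 0 < rho) by (apply Rmin_pos; lra).
  assert (rho <= 1 - Cmod a) by apply Rmin_l. assert (rho <= Cmod (a - b)) by apply Rmin_r.
  exists (rho / 8). split; [lra|]. intros x Hx Hxa eps He.
  set (eta := Rmin (1 / 2) (eps / 4)). assert (He0 : 0 < eta) by (apply Rmin_pos; lra).
  assert (eta <= 1 / 2) by apply Rmin_l. assert (eta <= eps / 4) by apply Rmin_r.
  destruct (nonvanishing_decay_eps eta He0) as [del [Hdel ND]].
  destruct (A del Hdel) as [N HN]. exists N. intros n Hn. specialize (HN n Hn).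
  set (q := cayley tau (Nat.iter n f b)) in *.
  assert (Pq : 0 < Re q) by (apply (orbit_Re_pos f tau lam Hs HJ n b Hb)).
  set (p z := cayley tau (Nat.iter n f z)). fold (p a) in HN. fold (p x).
  assert (Pp : forall z, Cmod z < 1 -> 0 < Re (p z)) by (intros; now apply (orbit_Re_pos f tau lam Hs HJ n z)).
  assert (Dn : forall z, Cmod z < 1 -> Re q <= Cmod (p z + Cconj q)).
  { intros z Hz. eapply Rle_trans; [|apply Re_le_Cmod]. rewrite re_plus, re_conj. generalize (Pp z Hz). lra. }
  assert (Nz : forall z, Cmod z < 1 -> (p z + Cconj q)%C <> 0%C).
  { intros z Hz. apply Cmod_pos_neq. generalize (Dn z Hz). lra. }
  set (F z := ((p z - q) / (p z + Cconj q))%C).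
  assert (In : forall z, Cmod (z - a) < rho -> Cmod z < 1).
  { intros z Hz. generalize (Cmod_minus_ge z a). lra. }
  rewrite Cmult_1_l in *.
  assert (HF : Cmod (F x) <= eta).
  { apply (ND F a x rho); [| | |lra|].
    - intros z Hz. apply In in Hz. unfold F.
      assert (cdiff p z).
      { unfold p. apply (cdiff_comp (Nat.iter n f) (cayley tau)); [now apply hol_iter|].
        apply cayley_cdiff; auto. now apply iter_disc. }
      apply cdiff_div; [apply cdiff_minus|apply cdiff_plus|now apply Nz]; auto; apply cdiff_const.
    - intros z Hz. apply In in Hz. unfold F. rewrite Cmod_div by now apply Nz.
      assert (P0 := proj1 (Cmod_gt_0 _) (Nz z Hz)).
      apply Rle_div_l; [lra|]. rewrite Rmult_1_l. apply sqr_le_inv; [lra|].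
      rewrite Cmod_conj_plus_identity. assert (P1 := Pp z Hz). nra.
    - intros z Hz E. assert (Hz1 := In z Hz). apply (f_equal Cmod) in E. unfold F in E.
      rewrite Cmod_div, Cmod_0 in E by now apply Nz.
      assert (P0 := proj1 (Cmod_gt_0 _) (Nz z Hz1)).
      assert (E0 : Cmod (p z - q) = 0).
      { replace (Cmod (p z - q)) with (Cmod (p z - q) / Cmod (p z + Cconj q) * Cmod (p z + Cconj q))
          by (field; lra). rewrite E; ring. }
      apply Cmod_eq_0 in E0.
      assert (E1 : p z = q) by (replace (p z) with (p z - q + q)%C by ring; rewrite E0; ring).
      apply cayley_inj in E1; auto using iter_disc.
      apply iter_injective in E1; auto. subst z.
      rewrite Cmod_minus_sym in Hz. lra.
    - unfold F. rewrite Cmod_div by now apply Nz. assert (P0 := Dn a Ha).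
      apply Rle_div_l; [lra|]. eapply Rle_trans; [exact HN|]. apply Rmult_le_compat_l; lra. }
  unfold F in HF. rewrite Cmod_div in HF by now apply Nz.
  assert (P0 := Dn x Hx). apply div_le_mul in HF; [|lra].
  assert (Cmod (p x + Cconj q) <= Cmod (p x - q) + 2 * Re q).
  { replace (p x + Cconj q)%C with ((p x - q) + RtoC (2 * Re q))%C.
    - eapply Rle_trans; [apply Cmod_triangle|]. rewrite Cmod_R, Rabs_pos_eq by lra. lra.
    - unfold Cconj, Cminus, Cplus, Copp, RtoC, Re; simpl. f_equal; ring. }
  set (X := Cmod (p x - q)) in *. assert (0 <= X) by apply Cmod_ge_0.
  assert (X <= eta * (X + 2 * Re q)) by nra.
  assert (eta * X <= 1 / 2 * X) by (apply Rmult_le_compat_r; lra).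
  assert (eta * Re q <= eps / 4 * Re q) by (apply Rmult_le_compat_r; lra). lra.
Qed.

(** By the Schwarz-Pick lemma the iterates of [f] are equicontinuous for the
    hyperbolic distance. *)
Lemma merging_closed x v : Cmod x < 1 -> Cmod v < 1 ->
  (forall d, 0 < d -> exists y, Cmod y < 1 /\ Cmod (y - x) < d /\ merging y v) -> merging x v.
Proof using Hf Hs HJ.
  intros Hx Hv H eps He.
  set (eta := Rmin (1 / 4) (eps / 16)). assert (He0 : 0 < eta) by (apply Rmin_pos; lra).
  assert (eta <= 1 / 4) by apply Rmin_l. assert (eta <= eps / 16) by apply Rmin_r.
  set (k := 1 - Cmod x). assert (Hk : 0 < k) by (unfold k; lra).
  set (d := Rmin (k / 2) (eta * k / 2)).
  assert (Hd : 0 < d) by (apply Rmin_pos; nra).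
  assert (d <= k / 2) by apply Rmin_l. assert (d <= eta * k / 2) by apply Rmin_r.
  destruct (H d Hd) as [y (Hy & Hyx & Ay)].
  set (e1 := Rmin 1 (eps / 2)). assert (0 < e1) by (apply Rmin_pos; lra).
  assert (e1 <= 1) by apply Rmin_l. assert (e1 <= eps / 2) by apply Rmin_r.
  destruct (Ay e1) as [N HN]; auto. exists N. intros n Hn. specialize (HN n Hn).
  rewrite Cmult_1_l in *.
  assert (D : sinh2_disc x y <= eta ^ 2).
  { unfold sinh2_disc. rewrite Cmod_minus_sym. assert (G1 := disc_gap x Hx). assert (G2 := disc_gap y Hy).
    assert (k / 2 <= 1 - Cmod y ^ 2).
    { generalize (Cmod_minus_ge y x) (Cmod_ge_0 y). intros. unfold k in *. nra. }
    assert (k / 2 <= 1 - Cmod x ^ 2).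
    { generalize (Cmod_ge_0 x). intros. unfold k in *. nra. }
    apply Rle_div_l; [nra|].
    apply Rle_trans with ((eta * k / 2) ^ 2).
    - apply pow_incr. split; [apply Cmod_ge_0|lra].
    - replace ((eta * k / 2) ^ 2) with (eta ^ 2 * (k / 2 * (k / 2))) by field.
      apply Rmult_le_compat_l; [nra|]. apply Rmult_le_compat; lra. }
  assert (SP := iter_schwarz_pick f n x y Hf Hs Hx Hy).
  rewrite <- (cayley_isometry tau) in SP; [|apply HJ|now apply iter_disc|now apply iter_disc].
  assert (Px := orbit_Re_pos f tau lam Hs HJ n x Hx). assert (Py := orbit_Re_pos f tau lam Hs HJ n y Hy).
  assert (Pv := orbit_Re_pos f tau lam Hs HJ n v Hv).
  set (U := cayley tau (Nat.iter n f x)) in *. set (Y := cayley tau (Nat.iter n f y)) in *.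
  set (V := cayley tau (Nat.iter n f v)) in *.
  assert (B := close_of_sinh2_half U Y eta Px Py ltac:(lra) ltac:(lra)).
  assert (RY : Re Y <= 2 * Re V).
  { assert (R : Re Y - Re V <= Cmod (Y - V)).
    { eapply Rle_trans; [|apply Re_le_Cmod]. unfold Re; simpl. right; ring. }
    nra. }
  eapply Rle_trans; [apply (Cmod_triangle_minus U Y V)|].
  assert (4 * eta * Re Y <= 4 * eta * (2 * Re V)) by (apply Rmult_le_compat_l; lra).
  assert (8 * eta * Re V <= eps / 2 * Re V) by (apply Rmult_le_compat_r; lra).
  assert (e1 * Re V <= eps / 2 * Re V) by (apply Rmult_le_compat_r; lra). lra.
Qed.

Lemma not_merging_image v : Cmod v < 1 -> ~ merging (f v) v.
Proof using Hs HJ.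
  intros Hv A. destruct HJ as (Ht & Hl & J).
  destruct (A ((lam - 1) / 2) ltac:(lra)) as [N HN]. specialize (HN N (Nat.le_refl N)).
  rewrite Cmult_1_l in HN. rewrite <- Nat.iter_succ_r in HN.
  change (Nat.iter (S N) f v) with (f (Nat.iter N f v)) in HN.
  specialize (J (Nat.iter N f v) (iter_disc f N v Hs Hv)).
  assert (P := orbit_Re_pos f tau lam Hs HJ N v Hv).
  set (V := cayley tau (Nat.iter N f v)) in *. set (U := cayley tau (f (Nat.iter N f v))) in *.
  assert (R : Re U - Re V <= Cmod (U - V)).
  { eapply Rle_trans; [|apply Re_le_Cmod]. unfold Re; simpl. right; ring. }
  nra.
Qed.

(** If [u <> v], the set of points whose orbits merge with that of [v] is open at
    each of its points [a]: [merging_local] needs a second point [b <> a] of the set, and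
    [u] or [v] will do.  Following the segment from [v] to [f v], this set would
    contain [f v], against [not_merging_image]. *)
Lemma merging_eq u v : Cmod u < 1 -> Cmod v < 1 -> merging u v -> u = v.
Proof using Hf Hs Hi HJ.
  intros Hu Hv A. destruct (Ceq_dec u v) as [|n]; auto. exfalso.
  set (gam t := (v + RtoC t * (f v - v))%C).
  assert (Hfv : Cmod (f v) < 1) by (apply Hs; auto).
  assert (G1 : forall t, 0 <= t <= 1 -> Cmod (gam t) < 1).
  { intros t Ht. unfold gam.
    replace (v + RtoC t * (f v - v))%C with (RtoC (1 - t) * v + RtoC t * f v)%C by (rewrite RtoC_minus; ring).
    eapply Rle_lt_trans; [apply Cmod_triangle|]. rewrite !Cmod_mult, !Cmod_R, !Rabs_pos_eq by lra.
    destruct (Req_dec t 0) as [->|]; nra. }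
  set (L := Cmod (f v - v)). assert (HL : 0 <= L) by apply Cmod_ge_0.
  assert (G2 : forall s t d, 0 < d -> Rabs (s - t) < d / (L + 1) -> Cmod (gam s - gam t) < d).
  { intros s t d Hd H. unfold gam.
    replace (v + RtoC s * (f v - v) - (v + RtoC t * (f v - v)))%C with (RtoC (s - t) * (f v - v))%C
      by (rewrite RtoC_minus; ring).
    rewrite Cmod_mult, Cmod_R. fold L.
    assert (Rabs (s - t) * (L + 1) < d) by (apply Rlt_div_r; lra).
    generalize (Rabs_pos (s - t)). nra. }
  assert (Gpos : forall d, 0 < d -> 0 < d / (L + 1)) by (intros; apply Rdiv_lt_0_compat; lra).
  apply (not_merging_image v Hv).
  replace (f v) with (gam 1) by (unfold gam; ring).
  apply (interval_connected (fun t => merging (gam t) v)); cbv beta.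
  - replace (gam 0) with v by (unfold gam; ring). now apply merging_refl.
  - intros t Ht E. assert (G1t := G1 t Ht).
    assert (Hb : exists b, Cmod b < 1 /\ b <> gam t /\ merging b v).
    { destruct (Ceq_dec v (gam t)) as [Ev|Ev].
      - exists u. repeat split; auto. rewrite <- Ev. auto.
      - exists v. repeat split; auto. now apply merging_refl. }
    destruct Hb as [b (Hb1 & Hb2 & Hb3)].
    destruct (merging_local (gam t) b) as [r [Hr H]]; auto.
    { apply merging_trans with v; auto. now apply merging_sym. }
    exists (r / (L + 1)). split; [auto|]. intros s Hs2 Hst.
    apply merging_trans with b; auto.
  - intros t Ht H. apply merging_closed; auto. intros d Hd.
    destruct (H (d / (L + 1)) (Gpos d Hd)) as [s (Hs1 & Hs2 & Hs3)].
    exists (gam s). auto.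
Qed.

End Hurwitz.

(** * Commuting maps *)

Lemma centralizer_facts (f g : C -> C) : centralizer f g ->
  hol g /\ self_map g /\ injective_on_disc g /\ forall z, Cmod z < 1 -> f (g z) = g (f z).
Proof.
  intros [[H1 [H2 H3]] H4]. repeat split; auto. now apply hol_of_holomorphic.
Qed.

Lemma centralizer_commutative (f g h : C -> C) (tau : C) (lam : R) : univalent_self_map f ->
  julia_expanding f tau lam -> centralizer f g -> centralizer f h ->
  forall z, Cmod z < 1 -> g (h z) = h (g z).
Proof.
  intros [Hf [Hs Hi]] HJ Cg Ch z Hz. apply hol_of_holomorphic in Hf.
  apply centralizer_facts in Cg. destruct Cg as (Hg & Sg & _ & Eg).
  apply centralizer_facts in Ch. destruct Ch as (Hh & Sh & _ & Eh).
  destruct (commuting_multiplier f tau lam Hf Hs HJ g Hg Sg Eg) as [c [Hc Ag]].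
  destruct (commuting_multiplier f tau lam Hf Hs HJ h Hh Sh Eh) as [c' [Hc' Ah]].
  assert (Hgz : Cmod (g z) < 1) by (apply Sg; auto). assert (Hhz : Cmod (h z) < 1) by (apply Sh; auto).
  assert (Hgh : Cmod (g (h z)) < 1) by (apply Sg; auto). assert (Hhg : Cmod (h (g z)) < 1) by (apply Sh; auto).
  apply (merging_eq f tau lam); auto.
  assert (A1 : asymptotic f tau (c * c') (g (h z)) z).
  { apply (asymptotic_trans f tau lam Hs HJ c c' _ (h z)); auto; lra. }
  assert (A2 : asymptotic f tau (c * c') (h (g z)) z).
  { rewrite Rmult_comm. apply (asymptotic_trans f tau lam Hs HJ c' c _ (g z)); auto; lra. }
  assert (A3 : asymptotic f tau (/ (c * c')) z (h (g z))).
  { apply (asymptotic_sym f tau lam); auto. nra. }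
  rewrite <- (Rinv_r (c * c')) by nra.
  apply (asymptotic_trans f tau lam Hs HJ _ _ _ z); auto; [nra|]. left. apply Rinv_0_lt_compat. nra.
Qed.

(** A sequence [y k <= M * q ^ k] of positive numbers satisfies
    [y (S k) <= q' * y k] infinitely often, for any [q'] between [q] and [1].  At a
    cluster point of the corresponding iterates, Julia's lemma applies with factor
    [q']. *)
Lemma geometric_escape_julia_expanding (g : C -> C) (q M : R) : hol g -> self_map g ->
  0 < q < 1 -> (forall k, 1 - Cmod (Nat.iter k g 0%C) ^ 2 <= M * q ^ k) ->
  exists tau lam, julia_expanding g tau lam.
Proof.
  intros Hg Hs Hq Hgeo.
  assert (D0 : Cmod 0%C < 1) by (rewrite Cmod_0; lra).
  set (x k := Nat.iter k g 0%C). set (y k := 1 - Cmod (x k) ^ 2).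
  assert (Hx : forall k, Cmod (x k) < 1) by (intros; now apply iter_disc).
  assert (Hy : forall k, 0 < y k) by (intros; apply disc_gap, Hx).
  assert (Hyq : forall k, y k <= M * q ^ k) by exact Hgeo.
  assert (HM : 0 < M) by (generalize (Hyq O) (Hy O); simpl; lra).
  (* Any number strictly between [q] and [1]. *)
  set (q' := (1 + q) / 2). assert (Hq' : q < q' < 1) by (unfold q'; lra).
  assert (Fr : frequently (fun k => y (S k) <= q' * y k)).
  { intros N. apply NNPP. intros no.
    assert (Gr : forall j, q' ^ j * y N <= y (N + j)%nat).
    { induction j; [rewrite Nat.add_0_r; simpl; lra|]. rewrite Nat.add_succ_r.
      apply Rnot_lt_le. intros L. apply no. exists (N + j)%nat. split; [lia|].
      rewrite <- tech_pow_Rmult in L. nra. }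
    destruct (Pow_x_infinity (q' / q)) with (b := M * q ^ N / y N + 1) as [j Hj].
    { assert (1 < q' / q) by (apply Rlt_div_r; lra). rewrite Rabs_pos_eq; lra. }
    specialize (Hj j (Nat.le_refl j)). specialize (Gr j). specialize (Hyq (N + j)%nat).
    assert (0 < q' / q) by (apply Rdiv_lt_0_compat; lra).
    rewrite Rabs_pos_eq in Hj by (apply pow_le; lra).
    rewrite pow_add in Hyq. unfold Rdiv in Hj at 1. rewrite Rpow_mult_distr, pow_inv in Hj.
    assert (Pj : 0 < q ^ j) by (apply pow_lt; lra). assert (PN := Hy N).
    assert (q' ^ j * / q ^ j <= M * q ^ N / y N); [|lra].
    apply (Rle_div_r _ _ _ PN).
    replace (q' ^ j * / q ^ j * y N) with (q' ^ j * y N / q ^ j) by (field; lra).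
    apply (Rle_div_l _ _ _ Pj). lra. }
  destruct (complex_cluster _ x 1 ltac:(intros; left; apply Hx) Fr) as [tau Htau].
  assert (Small : forall d, 0 < d -> exists N, forall k, (N <= k)%nat -> y k < d).
  { intros d Hd. destruct (pow_lt_1_zero q) with (y := d / M) as [N HN].
    - rewrite Rabs_pos_eq; lra.
    - now apply Rdiv_lt_0_compat.
    - exists N. intros k Hk. specialize (HN k Hk). rewrite Rabs_pos_eq in HN by (apply pow_le; lra).
      specialize (Hyq k).
      assert (q ^ k * M < d) by (apply (Rlt_div_r _ _ _ HM); auto). lra. }
  assert (Ht : Cmod tau = 1).
  { apply Rle_antisym; apply le_epsilon; intros e He.
    - destruct (Htau e He O) as [k (_ & _ & Hk)].
      generalize (Cmod_minus_ge tau (x k)) (Hx k). rewrite (Cmod_minus_sym tau). lra.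
    - destruct (Small (e / 2) ltac:(lra)) as [N HN].
      destruct (Htau (e / 2) ltac:(lra) N) as [k (Hk1 & _ & Hk)]. specialize (HN k Hk1).
      generalize (Cmod_minus_ge (x k) tau) (Hx k) (Cmod_ge_0 (x k)). intros.
      assert (1 - Cmod (x k) <= y k) by (unfold y; nra). lra. }
  exists tau, (/ q'). apply julia_expanding_of_contact; auto; [lra|].
  intros eps He. set (D := sinh2_disc (x 1%nat) (x O)). assert (HD : 0 <= D) by now apply sinh2_disc_nonneg.
  destruct (Small (eps / (2 * (D + 1)))) as [N HN]; [apply Rdiv_lt_0_compat; lra|].
  destruct (Htau (eps / 2) ltac:(lra) N) as [k (Hk1 & Hk2 & Hk3)]. specialize (HN k Hk1).
  exists (x k). change (g (x k)) with (x (S k)).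
  assert (B : Cmod (x (S k) - x k) <= (D + 1) * y k).
  { assert (SP := iter_schwarz_pick g k (x 1%nat) (x O) Hg Hs (Hx _) (Hx _)). fold D in SP.
    assert (E1 : Nat.iter k g (x 1%nat) = x (S k)) by (unfold x; simpl; symmetry; apply Nat.iter_succ_r).
    assert (E0 : Nat.iter k g (x O) = x k) by reflexivity.
    rewrite E1, E0 in SP. unfold sinh2_disc in SP. fold (y k) (y (S k)) in SP.
    assert (P1 := Hy k). assert (P2 := Hy (S k)).
    apply div_le_mul in SP; [|nra]. apply sqr_le_inv; [nra|]. eapply Rle_trans; [exact SP|].
    assert (y (S k) <= y k) by nra.
    apply Rle_trans with (D * (y k * y k)).
    - apply Rmult_le_compat_l; auto. apply Rmult_le_compat_r; lra.
    - replace (((D + 1) * y k) ^ 2) with ((D + 1) ^ 2 * (y k * y k)) by ring.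
      apply Rmult_le_compat_r; nra. }
  assert (HN' : y k * (2 * (D + 1)) < eps) by (apply (Rlt_div_r (y k) eps (2 * (D + 1))); lra).
  split; [auto|]. split; [lra|]. split; [|exact Hk2].
  generalize (Cmod_triangle_minus (x (S k)) (x k) tau). lra.
Qed.

(** The multiplier of the [k]-th iterate of [g] is [c ^ k], so [asymptotic_separation]
    bounds [1 - |g^k 0| ^ 2] by [4 * c ^ k / (c ^ k + 1) ^ 2].  This decays geometrically
    whether [c < 1] or [c > 1]. *)
Lemma commuting_julia_expanding (f g : C -> C) (tau : C) (lam : R) : univalent_self_map f ->
  julia_expanding f tau lam -> centralizer f g -> ~ eq_on_disc g (fun z => z) ->
  exists sigma mu, julia_expanding g sigma mu.
Proof.
  intros [Hf [Hs Hi]] HJ Cg Nid. apply hol_of_holomorphic in Hf.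
  apply centralizer_facts in Cg. destruct Cg as (Hg & Sg & _ & Eg).
  destruct (commuting_multiplier f tau lam Hf Hs HJ g Hg Sg Eg) as [c [Hc Ag]].
  assert (D0 : Cmod 0%C < 1) by (rewrite Cmod_0; lra).
  assert (c1 : c <> 1).
  { intros ->. apply Nid. intros z Hz. apply (merging_eq f tau lam); auto. exact (Sg z Hz). }
  assert (Ak : forall k, asymptotic f tau (c ^ k) (Nat.iter k g 0%C) 0%C).
  { induction k; [now apply (merging_refl f tau lam)|].
    rewrite <- tech_pow_Rmult.
    assert (Hk := iter_disc g k 0%C Sg D0).
    apply (asymptotic_trans f tau lam Hs HJ c (c ^ k) _ (Nat.iter k g 0%C)); auto; try lra.
    - apply pow_le; lra.
    - simpl. auto. }
  assert (Y : forall k, (c ^ k + 1) ^ 2 * (1 - Cmod (Nat.iter k g 0%C) ^ 2) <= 4 * c ^ k).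
  { intros k. assert (Hk := iter_disc g k 0%C Sg D0).
    assert (L := asymptotic_separation f tau lam Hf Hs HJ (c ^ k) _ _ Hk D0 (Ak k)).
    unfold sinh2_disc in L. rewrite Cmod_0 in L. replace (Nat.iter k g 0 - 0)%C with (Nat.iter k g 0%C) in L by ring.
    assert (G := disc_gap _ Hk). set (y := 1 - Cmod (Nat.iter k g 0%C) ^ 2) in *.
    replace (Cmod (Nat.iter k g 0%C) ^ 2) with (1 - y) in L by (unfold y; ring).
    assert (P := pow_lt c k Hc). set (C := c ^ k) in *.
    replace (4 * C * ((1 - y) / (y * (1 - 0 ^ 2)))) with (4 * C * (1 - y) / y) in L by (field; lra).
    apply (proj2 (Rle_div_r _ _ _ G)) in L. nra. }
  assert (Pos : forall k, 0 < 1 - Cmod (Nat.iter k g 0%C) ^ 2) by (intros; now apply disc_gap, iter_disc).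
  destruct (Rlt_dec c 1) as [L|L].
  - apply (geometric_escape_julia_expanding g c 4); auto.
    intros k. specialize (Y k). specialize (Pos k). assert (P := pow_lt c k Hc). nra.
  - apply (geometric_escape_julia_expanding g (/ c) 4); auto.
    + split; [now apply Rinv_0_lt_compat|]. rewrite <- Rinv_1. apply Rinv_lt_contravar; lra.
    + intros k. specialize (Y k). specialize (Pos k). assert (P := pow_lt c k Hc).
      rewrite pow_inv. apply Rle_div_r; auto.
      set (y := 1 - Cmod (Nat.iter k g 0%C) ^ 2) in *. set (C := c ^ k) in *.
      assert (C * (y * C) <= C * 4) by nra. nra.
Qed.

Theorem proposition6p6 :
  forall phi psi : C -> C,
    univalent_self_map phi ->
    hyperbolic phi ->
    centralizer phi psi ->
    ~ eq_on_disc phi (fun z => z) ->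
    ~ eq_on_disc psi (fun z => z) ->
    forall chi : C -> C, centralizer psi chi <-> centralizer phi chi.
Proof.
  intros phi psi Uphi Hphi Cpsi _ Npsi chi.
  destruct (hyperbolic_julia_expanding phi Hphi) as (tau & lam & HJ).
  destruct (commuting_julia_expanding phi psi tau lam Uphi HJ Cpsi Npsi) as (sigma & mu & HJ').
  destruct Cpsi as [Upsi Epsi].
  split; intros Cchi; (split; [apply Cchi|]).
  - intros z Hz. apply (centralizer_commutative psi phi chi sigma mu); auto.
    split; auto. intros w Hw. symmetry. now apply Epsi.
  - intros z Hz. apply (centralizer_commutative phi psi chi tau lam); auto. now split.
Qed.
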